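(* Let $(M,d)$ be a separable metric space such that every separable reflexive asymptotic-$c_0$ Banach space coarsely embeds into $(M,d)$. Then every separable metric space coarsely embeds into $(M,d)$ (equivalently, $c_0$ coarsely embeds into $(M,d)$).
   Context: A map $f:X\to Y$ between metric spaces is a coarse embedding if there are non-decreasing $\rho,\omega:[0,\infty)\to[0,\infty)$ with $\lim_{t\to\infty}\rho(t)=\infty$ and $\rho(d_X(x,y))\le d_Y(f(x),f(y))\le\omega(d_X(x,y))$ for all $x,y$. A Banach space $X$ is asymptotic-$c_0$ if there is $C\ge1$ such that for every $n\in\mathbb{N}$ there is a finite-codimensional subspace $X_1$ such that for every $x_1\in S_{X_1}$ there is a finite-codimensional subspace $X_2$ such that ... for every $x_n\in S_{X_n}$, the sequence $(x_i)_{i=1}^n$ is $C$-equivalent to the unit vector basis of $\ell_\infty^n$. *)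

(* Defs.v *)
From HB Require Import structures.
From mathcomp Require Import all_boot all_order all_algebra.
From mathcomp Require Import all_classical all_reals all_analysis.
Set Implicit Arguments. Unset Strict Implicit. Unset Printing Implicit Defensive.
Import Order.TTheory GRing.Theory Num.Theory.
Import numFieldNormedType.Exports.
Local Open Scope classical_set_scope.
Local Open Scope ring_scope.

Section Defs.
Variable R : realType.

Record metric_space := MetricSpace {
  ms_carrier :> Type;
  ms_dist : ms_carrier -> ms_carrier -> R;
  ms_dist_self : forall x, ms_dist x x = 0;
  ms_dist_eq0 : forall x y, ms_dist x y = 0 -> x = y;
  ms_dist_sym : forall x y, ms_dist x y = ms_dist y x;
  ms_dist_triangle : forall x y z, ms_dist x z <= ms_dist x y + ms_dist y z
}.

Definition separable_dist (T : Type) (d : T -> T -> R) : Prop :=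
  exists S : set T, countable S /\
    forall x (eps : R), 0 < eps -> exists2 s, S s & d x s < eps.

Definition separable_ms (M : metric_space) := separable_dist (@ms_dist M).

Definition norm_dist (X : normedModType R) (x y : X) : R := `|x - y|.

Definition coarse_embedding (X Y : Type) (dX : X -> X -> R) (dY : Y -> Y -> R)
    (f : X -> Y) : Prop :=
  exists rho omega : R -> R,
    (forall t, 0 <= t -> 0 <= rho t /\ 0 <= omega t) /\
    (forall s t, 0 <= s -> s <= t -> rho s <= rho t /\ omega s <= omega t) /\
    (forall K : R, exists T : R, forall t, T <= t -> K <= rho t) /\
    (forall x y, rho (dX x y) <= dY (f x) (f y) /\ dY (f x) (f y) <= omega (dX x y)).

Section Banach.
Variable X : completeNormedModType R.

Definition is_subspace (V : set X) : Prop :=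
  V 0 /\ (forall (a : R) x y, V x -> V y -> V (a *: x + y)).

Definition fin_codim_subspace (V : set X) : Prop :=
  is_subspace V /\ closed V /\
  exists (n : nat) (e : 'I_n -> X), forall x : X,
    exists v, V v /\ exists a : 'I_n -> R, x = v + \sum_(i < n) a i *: e i.

Definition equiv_linf (C : R) (s : seq X) : Prop :=
  exists A B : R, 0 < A /\ 0 < B /\ A * B <= C /\
    forall a : 'I_(size s) -> R,
      A^-1 * (\big[Num.max/0]_(i < size s) `|a i|)
        <= `| \sum_(i < size s) a i *: nth 0 s i | /\
      `| \sum_(i < size s) a i *: nth 0 s i |
        <= B * (\big[Num.max/0]_(i < size s) `|a i|).

Fixpoint asym_game (C : R) (m : nat) (s : seq X) : Prop :=
  match m with
  | 0 => equiv_linf C s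
  | m'.+1 => exists V : set X, fin_codim_subspace V /\
      forall x : X, V x -> `|x| = 1 -> asym_game C m' (rcons s x)
  end.

Definition asymptotic_c0 : Prop :=
  exists C : R, 1 <= C /\ forall n : nat, asym_game C n [::].

Definition separable_normed : Prop := separable_dist (@norm_dist X).

Definition dual_elt (f : X -> R) : Prop :=
  (forall (a : R) x y, f (a *: x + y) = a * f x + f y) /\ continuous f.

(** Bidual: bounded linear functionals on the dual (with the operator norm). *)
Definition bidual_elt (Phi : (X -> R) -> R) : Prop :=
  (forall (a : R) f g, dual_elt f -> dual_elt g ->
     Phi (fun x => a * f x + g x) = a * Phi f + Phi g) /\
  exists K : R, forall f (c : R), dual_elt f -> 0 <= c ->
     (forall x, `|f x| <= c * `|x|) -> `|Phi f| <= K * c.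

Definition reflexive_space : Prop :=
  forall Phi, bidual_elt Phi -> exists x : X, forall f, dual_elt f -> Phi f = f x.

End Banach.
End Defs.

(* Main.v *)
(* If no coarse embedding of N into M existed, the finite attempts to build one
   on a dense sequence of N with values in a dense sequence of M would form a
   countable tree without infinite branch.  For such a tree put
     |y| = sup over antichains A of the norm of y restricted to A in T*,
   T* being Tsirelson's original space.  On every branch this is the sup norm, so
   branches carry isometric copies of l_infty^n; the space inherits from T* the
   asymptotic-c0 property, and therefore has a shrinking basis.  It is reflexive
   because the basis is also boundedly complete: by well-foundedness, a
   sequence of blocks whose norms do not tend to 0 can be thinned out to blocks
   supported on one antichain, where the norm is that of T*.

   Hence the space embeds coarsely into M.  Map N by a coarse version of
   Aharoni's theorem into finitely supported sequences, and place their
   coordinates along a branch which is extended at each step by the images in M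
   just obtained: the attempts so produced form an infinite branch of the tree,
   a contradiction. *)
Require Import Defs.
From HB Require Import structures.
From mathcomp Require Import all_boot all_order all_algebra.
From mathcomp Require Import all_classical all_reals all_analysis.
From mathcomp Require Import ring lra zify.
Set Implicit Arguments.
Unset Strict Implicit.
Unset Printing Implicit Defensive.
Import Order.TTheory GRing.Theory Num.Theory.
Import numFieldNormedType.Exports.
Local Open Scope classical_set_scope.
Local Open Scope ring_scope.

(** * Tsirelson's space *)

Section Pairing.
Variable R : realType.
Implicit Types (y w s : nat -> R) (p : {poly R}).

Definition dot y p : R := \sum_(i < size p) y i * p`_i.

Lemma dot_widen N y p : (size p <= N)%N -> dot y p = \sum_(i < N) y i * p`_i.
Proof.
move=> pN; rewrite /dot (big_ord_widen N (fun i => y i * p`_i)) //.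
rewrite big_mkcond /=; apply: eq_bigr => i _; case: ltnP => // pi.
by rewrite nth_default // mulr0.
Qed.

Lemma dotDr y p p' : dot y (p + p') = dot y p + dot y p'.
Proof.
pose N := maxn (size p) (size p').
rewrite !(@dot_widen N) ?leq_maxl ?leq_maxr ?size_polyD // -big_split /=.
by apply: eq_bigr => i _; rewrite coefD mulrDr.
Qed.

Lemma dotZr y a p : dot y (a *: p) = a * dot y p.
Proof.
rewrite !(@dot_widen (size p)) ?size_scale_leq // mulr_sumr.
by apply: eq_bigr => i _; rewrite coefZ mulrCA.
Qed.

Lemma dot0r y : dot y 0 = 0.
Proof. by rewrite -(scale0r 0) dotZr mul0r. Qed.

Lemma dot_sumr y n (p : nat -> {poly R}) :
  dot y (\sum_(k < n) p k) = \sum_(k < n) dot y (p k).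
Proof.
elim: n => [|n IH]; first by rewrite !big_ord0 dot0r.
by rewrite !big_ord_recr /= dotDr IH.
Qed.

Lemma dotDl y y' p : dot (y + y') p = dot y p + dot y' p.
Proof. by rewrite /dot -big_split /=; apply: eq_bigr => i _; rewrite mulrDl. Qed.

Lemma dotNl y p : dot (- y) p = - dot y p.
Proof. by rewrite /dot -sumrN; apply: eq_bigr => i _; rewrite mulNr. Qed.

Lemma dotZl a y p : dot (fun i => a * y i) p = a * dot y p.
Proof. by rewrite /dot mulr_sumr; apply: eq_bigr => i _; rewrite mulrA. Qed.

Lemma dot0l p : dot (fun=> 0) p = 0.
Proof. by rewrite /dot big1 // => i _; rewrite mul0r. Qed.

Lemma dot_suml n (y : nat -> nat -> R) p :
  dot (fun j => \sum_(i < n) y i j) p = \sum_(i < n) dot (y i) p.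
Proof.
rewrite /dot exchange_big /=; apply: eq_bigr => j _.
by rewrite mulr_suml.
Qed.

Lemma dot_eq y y' p : (forall i, p`_i != 0 -> y i = y' i) -> dot y p = dot y' p.
Proof.
move=> yy; apply: eq_bigr => i _; have [->|p0] := eqVneq p`_i 0.
  by rewrite !mulr0.
by rewrite yy.
Qed.

Lemma dot_monomial y i : dot y 'X^i = y i.
Proof.
rewrite /dot size_polyXn big_ord_recr /= coefXn eqxx mulr1 big1 ?add0r // => j _.
by rewrite coefXn ltn_eqF // mulr0.
Qed.

Lemma dot_delta c i p : dot (fun j => c *+ (j == i)) p = c * p`_i.
Proof.
rewrite (@dot_widen (maxn (size p) i.+1)) ?leq_maxl //.
have iN : (i < maxn (size p) i.+1)%N by rewrite leq_max ltnSn orbT.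
rewrite (bigD1 (Ordinal iN)) //= eqxx mulr1n big1 ?addr0 // => j ji.
by rewrite -val_eqE /= in ji; rewrite (negbTE ji) mul0r.
Qed.

Definition pmask s p : {poly R} := \poly_(i < size p) (s i * p`_i).

Lemma coef_pmask s p i : (pmask s p)`_i = s i * p`_i.
Proof.
rewrite coef_poly; case: ltnP => // pi.
by rewrite nth_default // mulr0.
Qed.

Lemma dot_pmask y s p : dot y (pmask s p) = dot (fun i => s i * y i) p.
Proof.
rewrite (dot_widen y (size_poly _ _)); apply: eq_bigr => i _.
by rewrite coef_pmask mulrCA mulrA.
Qed.

End Pairing.

Lemma ler_sum_natr (R : realType) n (F : nat -> R) :
  (forall k, (k < n)%N -> F k <= 1) -> \sum_(k < n) F k <= n%:R.
Proof.
move=> F1; rewrite -[n in leRHS]card_ord -sumr_const.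
by apply: ler_sum => k _; apply: F1.
Qed.

(** * Norming functionals and averages of blocks *)

Section Tsirelson.
Variable R : realType.
Implicit Types (y w s : nat -> R) (p : {poly R}).

(* The norming set of Tsirelson's space [T] (Figiel and Johnson); [tball] below is
   the unit ball of [T] on finitely supported vectors, which are encoded as
   polynomials. *)
Inductive tsirelson : (nat -> R) -> Prop :=
| tsirelson_unit i (c : R) : `|c| <= 1 -> tsirelson (fun j => c *+ (j == i))
| tsirelson_sum n (f : nat -> nat -> R) (q : nat -> nat) :
    (n <= q 0)%N -> {homo q : i j / (i <= j)%N} ->
    (forall i, (i < n)%N -> tsirelson (f i)) ->
    (forall i j, (i < n)%N -> f i j != 0 -> (q i <= j < q i.+1)%N) ->
    tsirelson (fun j => 2^-1 * \sum_(i < n) f i j).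

Lemma tsirelson_solid s w : (forall i, `|s i| <= 1) -> tsirelson w ->
  tsirelson (fun i => s i * w i).
Proof.
move=> s1; elim=> [i c c1|n f q nq homo_q Wf IH fq].
  rewrite (_ : (fun _ => _) = (fun j => (s i * c) *+ (j == i))).
    by apply: tsirelson_unit; rewrite normrM mulr_ile1.
  by apply/funext => j; case: eqP => [->|]; rewrite ?mulr0.
rewrite (_ : (fun _ => _) = (fun j => 2^-1 * \sum_(i < n) (s j * f i j))).
  apply: (@tsirelson_sum n (fun i j => s j * f i j) q) => // i j ni.
  by rewrite mulf_eq0 negb_or => /andP[_]; exact: fq.
by apply/funext => j; rewrite mulrCA mulr_sumr.
Qed.

Lemma tsirelson0 : tsirelson (fun=> 0).
Proof.
rewrite (_ : (fun=> 0) = (fun j => 0 *+ (j == 0))); last first.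
  by apply/funext => j; rewrite mul0rn.
by apply: tsirelson_unit; rewrite normr0.
Qed.

Definition tball : set {poly R} := [set p | forall w, tsirelson w -> dot w p <= 1].

Lemma tball_coef p i : tball p -> `|p`_i| <= 1.
Proof.
move=> Bp; rewrite ler_norml lerNl.
have /Bp := @tsirelson_unit i 1 (eq_ind_r (fun x => x <= 1) (lexx _) (normr1 _)).
have N1 : `|-1 : R| <= 1 by rewrite normrN normr1.
have /Bp := @tsirelson_unit i (-1) N1.
by rewrite !dot_delta mulN1r mul1r => -> ->.
Qed.

(** The blocks of a sum are disjoint, so at most one of them is nonzero at [i]. *)
Lemma tsirelson_bound w i : tsirelson w -> `|w i| <= 1.
Proof.
elim=> [j c c1|n f q nq homo_q Wf IH fq].
  by case: eqP => _; rewrite ?mulr1n ?mulr0n ?normr0.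
case: (pselect (exists k : 'I_n, f k i != 0)) => [[k fk]|]; last first.
  move=> /forallNP f0; rewrite big1 ?mulr0 ?normr0 // => k _.
  by apply/eqP/negPn/negP/f0.
rewrite (bigD1 k) //= big1 ?addr0.
  by rewrite normrM ger0_norm ?invr_ge0 // mulr_ile1 ?invr_ge0 ?IH // invf_le1 // ler1n.
move=> j jk; apply/eqP/negPn/negP => fj.
have /andP[qk kq] := fq _ _ (ltn_ord k) fk.
have /andP[qj jq] := fq _ _ (ltn_ord j) fj.
have : (j < k \/ k < j)%N by apply/orP; rewrite -neq_ltn.
by case=> /homo_q; lia.
Qed.

Lemma tball_pmask s p : (forall i, `|s i| <= 1) -> tball p -> tball (pmask s p).
Proof.
move=> s1 Bp w Ww; rewrite dot_pmask; apply: Bp.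
exact: tsirelson_solid.
Qed.

Lemma tball_monomial i : tball 'X^i.
Proof.
move=> w Ww; rewrite dot_monomial; apply: le_trans (ler_norm _) _.
exact: tsirelson_bound.
Qed.

(** Each indicator is a difference of two threshold indicators, so the sum telescopes. *)
Lemma count_block (s : nat -> nat) r (x : nat) : {homo s : i j / (i <= j)%N} ->
  \sum_(k < r) ((s k <= x < s k.+1)%N : nat)%:R <= 1 :> R.
Proof.
move=> homo_s.
have -> : \sum_(k < r) ((s k <= x < s k.+1)%N : nat)%:R
  = \sum_(k < r) (((s k <= x)%N : nat)%:R - ((s k.+1 <= x)%N : nat)%:R) :> R.
  apply: eq_bigr => k _; have := homo_s _ _ (leqnSn k).
  by case: (leqP (s k) x); case: (leqP (s k.+1) x) => //=; lia || (move=> *; lra).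
have -> : \sum_(k < r) (((s k <= x)%N : nat)%:R - ((s k.+1 <= x)%N : nat)%:R)
   = ((s 0 <= x)%N : nat)%:R - ((s r <= x)%N : nat)%:R :> R.
  elim: r => [|r IH]; first by rewrite big_ord0 subrr.
  by rewrite big_ord_recr /= IH; ring.
by case: leqP; case: leqP => //= *; lra.
Qed.

(* If two intervals meet, one of them contains the left endpoint of the other:
   hence [n] blocks and [r] blocks have at most [n + r] intersecting pairs. *)
Lemma dot_block_le1 w p (a b c d : nat) : tsirelson w -> tball p ->
  (forall j, w j != 0 -> (a <= j < b)%N) ->
  (forall j, p`_j != 0 -> (c <= j < d)%N) ->
  dot w p <= ((c <= a < d)%N : nat)%:R + ((a <= c < b)%N : nat)%:R.
Proof.
move=> Ww Bp wab pcd.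
case: (pselect (exists j, w j != 0 /\ p`_j != 0)) => [[j [/wab wj /pcd pj]]|N].
  apply: le_trans (Bp _ Ww) _; case: (leqP a c) => ac.
    by rewrite (_ : (c < b)%N) ?lerDr //; lia.
  by rewrite (_ : (c <= a < d)%N) ?lerDl //; lia.
rewrite (@dot_eq _ w (fun=> 0)); last first.
  by move=> i pi; apply/eqP/negPn/negP => wi; apply: N; exists i.
by rewrite dot0l addr_ge0.
Qed.

(** If the blocks of [w] start at [n0] or later, [w] ignores [x0] and is at most 1 on the average.
    Otherwise [n <= q 0 < n0 = r / 2], and the count of intersecting pairs bounds [w] on the average
    by [(n + r) / (2 * r) <= 3 / 4], besides 1 on [x0]. *)
Lemma tsirelson_average n0 r (x0 : {poly R}) (x : nat -> {poly R})
    (s : nat -> nat) w :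
  (0 < n0)%N -> r = (2 * n0)%N ->
  tball x0 -> (forall i, x0`_i != 0 -> (i < n0)%N) ->
  (forall k, tball (x k)) ->
  (n0 <= s 0)%N -> {homo s : i j / (i <= j)%N} ->
  (forall k i, (x k)`_i != 0 -> (s k <= i < s k.+1)%N) ->
  tsirelson w ->
  dot w (x0 + r%:R^-1 *: \sum_(k < r) x k) <= 7%:R / 4%:R.
Proof.
move=> n00 rE Bx0 x0n Bx ns homo_s xs Ww.
have r0 : 0 < r%:R :> R by rewrite ltr0n; lia.
have avg1 v : tsirelson v -> r%:R^-1 * dot v (\sum_(k < r) x k) <= 1.
  move=> Wv; rewrite ler_pdivrMl // mulr1 dot_sumr.
  by apply: (@ler_sum_natr _ _ (fun k => dot v (x k))) => k _; apply: Bx.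
rewrite dotDr dotZr.
case: Ww => [i c c1|n f q nq homo_q Wf fq].
- case: (ltnP i n0) => [in0|n0i].
    rewrite [X in _ + _ * X](_ : _ = 0).
      by have := Bx0 _ (tsirelson_unit i c1); rewrite mulr0 addr0; lra.
    rewrite dot_delta coef_sum big1 ?mulr0 // => k _.
    apply/eqP/negPn/negP => /xs /andP[ski _].
    by have := homo_s _ _ (leq0n k); lia.
  rewrite [X in X + _](_ : _ = 0).
    by have := avg1 _ (tsirelson_unit i c1); lra.
  rewrite dot_delta [x0`_i](_ : _ = 0) ?mulr0 //.
  by apply/eqP/negPn/negP => /x0n; lia.
- have Ww := tsirelson_sum nq homo_q Wf fq.
  case: (leqP n0 (q 0)) => [n0q|qn0].
    rewrite [X in X + _](_ : _ = 0); first by rewrite add0r; apply: le_trans (avg1 _ Ww) _; lra.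
    rewrite (@dot_eq _ _ (fun=> 0)) ?dot0l // => i /x0n in0.
    rewrite big1 ?mulr0 // => k _; apply/eqP/negPn/negP => /(fq _ _ (ltn_ord k)).
    have qk := homo_q _ _ (leq0n k); move=> /andP[qki _].
    by have := leq_trans n0q (leq_trans qk qki); rewrite leqNgt in0.
  have S : dot (fun j => \sum_(i < n) f i j) (\sum_(k < r) x k) <= n%:R + r%:R.
    rewrite dot_suml; under eq_bigr do rewrite dot_sumr.
    apply: (@le_trans _ _ (\sum_(i < n) \sum_(k < r)
      (((s k <= q i < s k.+1)%N : nat)%:R + ((q i <= s k < q i.+1)%N : nat)%:R))).
      apply: ler_sum => i _; apply: ler_sum => k _.
      apply: dot_block_le1 => //; [exact: Wf|by move=> j; exact: fq|exact: xs].
    under eq_bigr do rewrite big_split /=.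
    rewrite big_split /= lerD //.
      apply: (@ler_sum_natr _ _ (fun i => \sum_(k < r) ((s k <= q i < s k.+1)%N : nat)%:R)).
      by move=> i _; exact: count_block.
    rewrite exchange_big /=.
    apply: (@ler_sum_natr _ _ (fun k => \sum_(i < n) ((q i <= s k < q i.+1)%N : nat)%:R)).
    by move=> k _; exact: count_block.
  have := Bx0 _ Ww; rewrite !dotZl => H1.
  suff H2 : r%:R^-1 * (2^-1 * dot (fun j => \sum_(i < n) f i j) (\sum_(k < r) x k)) <= 3%:R/4%:R by lra.
  rewrite ler_pdivrMl //.
  have nr : (2 * n%:R <= r%:R :> R).
    by rewrite -natrM ler_nat rE leq_mul2l /= ltnW // (leq_ltn_trans nq qn0).
  set D := dot _ _ in S *.
  lra.
Qed.

(** The tails of [y] tend to 0 in the norm given by [G]; a one-sided bound suffices because the sets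
    [G] in use are closed under sign changes. *)
Definition tail_vanishes (G : set {poly R}) y := forall e : R, 0 < e ->
  exists N, forall p, G p -> (forall i, (i < N)%N -> p`_i = 0) -> dot y p <= e.

End Tsirelson.

(** Greedy choice: [s k.+1] is put past [s k] and past the support of the block chosen from [s k].
    The first argument of [P] lets a block depend on everything before its starting point. *)
Lemma block_sequence (R : realType) (P : nat -> {poly R} -> Prop) n0 :
  (forall N, exists2 p, P N p & forall i, (i < N)%N -> p`_i = 0) ->
  exists (x : nat -> {poly R}) (s : nat -> nat),
    [/\ s 0 = n0, {homo s : i j / (i < j)%N}, forall k, P (s k) (x k)
      & forall k i, (x k)`_i != 0 -> (s k <= i < s k.+1)%N].
Proof.
move=> exP.
have /choice[g gP] : forall N, exists p, P N p /\ forall i, (i < N)%N -> p`_i = 0.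
  by move=> N; have [p Pp p0] := exP N; exists p.
pose s := fix s k := if k is k'.+1 then maxn (s k').+1 (size (g (s k'))) else n0.
exists (g \o s), s; split=> // [||k i].
- by apply: (homo_ltn ltn_trans) => k; rewrite /= leq_max ltnSn.
- by move=> k; have [] := gP (s k).
move=> gi; apply/andP; split.
  by rewrite leqNgt; apply: contra gi => /(gP (s k)).2 ->.
rewrite /= leq_max ltnS; apply/orP; right; rewrite ltnNge.
by apply: contra gi => ?; rewrite nth_default.
Qed.

(** * Vanishing tails of functionals on Tsirelson's space *)

Section Tails.
Variable R : realType.
Implicit Types (y : nat -> R) (p : {poly R}) (E : set nat).

(* James' distortion argument: if the tail norms of [y] decrease to [c > 0], a
   vector far out plus the average of many later ones is almost [2]-normed by
   [y], although its Tsirelson norm is at most [7/4]. *)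
Lemma tball_tail_vanishes y : (exists C, forall p, tball p -> dot y p <= C) ->
  tail_vanishes (@tball R) y.
Proof.
move=> [C yC] e e0; apply/not_existsP => tail_e.
have far N : exists p, [/\ tball p, forall i, (i < N)%N -> p`_i = 0 & e < dot y p].
  have /existsNP[p /not_implyP[Bp /not_implyP[p0 /negP]]] := tail_e N.
  by rewrite -ltNge => ep; exists p.
pose A := [set c | exists N, forall p, tball p ->
  (forall i, (i < N)%N -> p`_i = 0) -> dot y p <= c].
have Ae a : A a -> e <= a.
  move=> [N Na]; have [p [Bp p0 ep]] := far N.
  exact/ltW/(lt_le_trans ep)/Na.
have infA : has_inf A.
  split; first by exists C, 0%N => p Bp _; exact: yC.
  by exists e => a /Ae.
have ge_e : e <= inf A by apply: lb_le_inf => //; exact: infA.1.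
(* The limit [inf A] of the tail norms lies strictly between [c] and [11/10 * c], whereas the vector
   [4/7 * z] below is in [tball] and has value above [8/7 * c]. *)
pose c := inf A * (20%:R / 21%:R).
have c0 : 0 < c by rewrite /c; lra.
have [a [N0 N0a] ac] : exists2 a, A a & a < c * (11%:R/10%:R).
  have e1 : 0 < c * (11%:R/10%:R) - inf A by rewrite /c; lra.
  by have [a Aa] := inf_adherent e1 infA; exists a => //; lra.
have farc N : exists2 p, tball p /\ c < dot y p & forall i, (i < N)%N -> p`_i = 0.
  apply: contrapT => /forall2NP Nc.
  suff : inf A <= c by rewrite /c; lra.
  apply: ge_inf; first exact: infA.2.
  exists N => p Bp p0; have [/not_andP[//|/negP]|//] := Nc p.
  by rewrite -leNgt.
have [x0 [Bx0 cx0] x00] := farc N0.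
have sx0 : (0 < size x0)%N.
  rewrite lt0n size_poly_eq0; apply: contraTneq cx0 => ->.
  by rewrite dot0r -leNgt ltW.
pose r := (2 * size x0)%N.
have [x [s [s0 homo_s xP xs]]] := @block_sequence R (fun _ p => tball p /\ c < dot y p)
  (size x0 + N0) farc.
have homo_s' : {homo s : i j / (i <= j)%N}.
  by apply: (homo_leq leqnn leq_trans) => k; exact/ltnW/homo_s.
pose z := x0 + r%:R^-1 *: \sum_(k < r) x k.
have r0 : 0 < r%:R :> R by rewrite ltr0n /r; lia.
have Bz : tball ((4%:R / 7%:R) *: z).
  move=> w Ww; rewrite dotZr.
  suff : dot w z <= 7%:R/4%:R by lra.
  apply: (@tsirelson_average R (size x0) r x0 x s) => //.
  - by move=> i; rewrite ltnNge; apply: contra => ?; rewrite nth_default.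
  - by move=> k; have [] := xP k.
  - by rewrite s0 leq_addr.
have z0 i : (i < N0)%N -> z`_i = 0.
  move=> iN0; rewrite coefD coefZ x00 // coef_sum big1 ?mulr0 ?addr0 // => k _.
  apply/eqP/negPn/negP => /xs /andP[ski _].
  have := leq_trans (homo_s' _ _ (leq0n k)) ski.
  by rewrite s0; lia.
have : dot y ((4%:R / 7%:R) *: z) <= a.
  by apply: N0a => // i iN0; rewrite coefZ z0 // mulr0.
rewrite dotZr dotDr dotZr dot_sumr.
have : c <= r%:R^-1 * \sum_(k < r) dot y (x k).
  rewrite ler_pdivlMl // mulr_natl -[X in _ *+ X]card_ord -sumr_const.
  by apply: ler_sum => k _; have [_ /ltW] := xP k.
lra.
Qed.

End Tails.

(** * Norms along antichains of a well-founded order *)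

Section AntichainSupports.
Variables (R : realType) (prec : nat -> nat -> Prop).
Implicit Types (y : nat -> R) (p : {poly R}) (E : set nat).

Definition antichain_supp p := forall i j, p`_i != 0 -> p`_j != 0 -> ~ prec i j.

Definition anti_ball : set {poly R} := [set p | tball p /\ antichain_supp p].

Definition above a : set nat := [set j | prec a j].

(** The bound on predecessors lets a block far out avoid everything below finitely many given
    points. *)
Definition tree_like := [/\ forall i, ~ prec i i, forall i j k, prec i j -> prec j k -> prec i k,
  forall j, exists b, forall i, prec i j -> (i < b)%N
  & ~ exists c : nat -> nat, forall k, prec (c k) (c k.+1)].

Hypothesis prec_tree : tree_like.

Lemma anti_ball_pmask (s : nat -> R) p :
  (forall i, `|s i| <= 1) -> anti_ball p -> anti_ball (pmask s p).
Proof.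
move=> s1 [Bp Ap]; split; first exact: tball_pmask.
move=> i j; rewrite !coef_pmask !mulf_eq0 !negb_or => /andP[_ ?] /andP[_ ?].
exact: Ap.
Qed.

Lemma anti_ball_monomial i : anti_ball 'X^i.
Proof.
split; first exact: tball_monomial.
move=> j k; rewrite !coefXn !pnatr_eq0 !eqb0 !negbK => /eqP -> /eqP ->.
by case: prec_tree.
Qed.

Lemma indic_le1 (E : set nat) i : `|\1_E i : R| <= 1.
Proof. by rewrite indicE; case: (_ \in _); rewrite ?normr1 ?normr0. Qed.

(** [E] is negligible for [y]; the next three lemmas show that such sets form an ideal. *)
Definition good y E := tail_vanishes anti_ball (fun i => \1_E i * y i).

Lemma good_subset y E E' : E' `<=` E -> good y E -> good y E'.
Proof.
move=> sub gE e e0; have [N NP] := gE e e0; exists N => p Gp p0.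
rewrite (_ : dot _ _ = dot (fun i => \1_E i * y i) (pmask \1_E' p)).
  apply: NP; first by apply: anti_ball_pmask => // i; exact: indic_le1.
  by move=> i iN; rewrite coef_pmask p0 // mulr0.
rewrite dot_pmask; apply: dot_eq => i _.
rewrite !indicE; case: (boolP (i \in E')); rewrite ?mul0r //.
by rewrite inE => /sub iE; rewrite mem_set // !mul1r.
Qed.

Lemma good_setU y E E' : good y E -> good y E' -> good y (E `|` E').
Proof.
move=> gE gE' e e0.
have [N NP] := gE _ (divr_gt0 e0 (ltr0Sn _ 1)).
have [N' NP'] := gE' _ (divr_gt0 e0 (ltr0Sn _ 1)).
exists (maxn N N') => p Gp p0.
have {}NP : dot (fun i => \1_E i * y i) p <= e / 2.
  by apply: NP => // i iN; rewrite p0 // leq_max iN.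
(* Masking [E] out of [p] keeps the common part of [E] and [E'] from being counted twice. *)
have {}NP' : dot (fun i => \1_E' i * y i) (pmask \1_(~` E) p) <= e / 2.
  apply: NP'; first by apply: anti_ball_pmask => // i; exact: indic_le1.
  by move=> i iN; rewrite coef_pmask p0 ?mulr0 // leq_max iN orbT.
rewrite (splitr e); apply: le_trans (lerD NP NP').
rewrite dot_pmask -dotDl le_eqVlt; apply/orP; left; apply/eqP.
apply: dot_eq => i _; rewrite [RHS]/GRing.add /= !indicE in_setU in_setC.
by case: (i \in E); case: (i \in E') => /=; ring.
Qed.

Lemma good_set0 y : good y set0.
Proof.
move=> e e0; exists 0%N => p _ _.
rewrite (_ : dot _ _ = 0) ?ltW // -[RHS](dot0l p); apply: dot_eq => i _.
by rewrite indicE in_set0 mul0r.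
Qed.

(* If the tails of [y] on [E] do not vanish, blocks on which [y] is at least [e / 2]
   can be chosen one after the other incomparable with all the previous ones:
   the part of [E] above finitely many points is negligible.  Their union is an
   antichain, on which [y] is a functional on Tsirelson's space. *)
Lemma good_step y E : (exists C, forall p, anti_ball p -> dot y p <= C) ->
  (forall a, E a -> good y (E `&` above a)) -> good y E.
Proof.
case: (prec_tree) => irr _ fin _ [C yC] gE e e0.
apply/not_existsP => tail_e.
have gU M : good y [set j | E j /\ exists2 a, (a < M)%N /\ E a & prec a j].
  elim: M => [|M IH].
    by apply: good_subset (@good_set0 y) => j [_ [a []]].
  have [EM|nEM] := pselect (E M).
    apply: good_subset (good_setU IH (gE _ EM)) => j [Ej [a [aM Ea] aj]].
    move: aM; rewrite ltnS leq_eqVlt => /predU1P[aM|aM].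
      by right; split=> //; rewrite -aM.
    by left; split=> //; exists a.
  apply: good_subset IH => j [Ej [a [aM Ea] aj]]; split=> //; exists a => //.
  split=> //; move: aM; rewrite ltnS leq_eqVlt => /predU1P[aM|//].
  by case: nEM; rewrite -aM.
have fin' M : exists b, forall a i, (a < M)%N -> prec i a -> (i < b)%N.
  elim: M => [|M [b IH]]; first by exists 0%N.
  have [b' b'P] := fin M; exists (maxn b b') => a i.
  rewrite ltnS leq_eqVlt leq_max => /predU1P[->|aM] ia.
    by rewrite (b'P _ ia) orbT.
  by rewrite (IH _ _ aM ia).
(* Of a value above [e] far out, at most [e / 2] is lost on the negligible part above earlier points
   of [E]. *)
pose P N p := [/\ anti_ball p, forall i, p`_i != 0 -> E i,
  forall i a, p`_i != 0 -> E a -> (a < N)%N -> ~ prec a i /\ ~ prec i a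
  & e / 2 < dot y p].
have exP N : exists2 p, P N p & forall i, (i < N)%N -> p`_i = 0.
  have [N1 N1P] := gU N _ (divr_gt0 e0 (ltr0Sn _ 1)).
  have [b bP] := fin' N.
  set U := [set j | _] in N1P.
  have /existsNP[p /not_implyP[Gp /not_implyP[p0 /negP]]] := tail_e (maxn N (maxn N1 b)).
  rewrite -ltNge => ep; exists (pmask \1_(E `\` U) p); last first.
    by move=> i iN; rewrite coef_pmask p0 ?mulr0 // !leq_max iN.
  have suppP i : (pmask \1_(E `\` U) p)`_i != 0 -> [/\ E i, ~ U i & p`_i != 0].
    rewrite coef_pmask mulf_eq0 negb_or indicE => /andP[+ pi].
    case: (boolP (i \in _)); last by rewrite eqxx.
    by rewrite inE => -[].
  split.
  - by apply: anti_ball_pmask => // i; exact: indic_le1.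
  - by move=> i /suppP[].
  - move=> i a /suppP[Ei Ui pi] Ea aN; split=> [ai|ia].
      by apply: Ui; split=> //; exists a.
    case/negP: pi; apply/eqP/p0; rewrite !leq_max.
    by rewrite (bP _ _ aN ia) !orbT.
  have {}N1P : dot (fun i => \1_U i * y i) p <= e / 2.
    by apply: N1P => // i iN; rewrite p0 // !leq_max iN orbT.
  suff : dot (fun i => \1_E i * y i) p =
    dot y (pmask \1_(E `\` U) p) + dot (fun i => \1_U i * y i) p.
    by move: ep N1P; lra.
  rewrite dot_pmask -dotDl; apply: dot_eq => i _.
  rewrite [RHS]/GRing.add /= -mulrDl; congr (_ * _).
  rewrite !indicE in_setD; case: (boolP (i \in U)) => [|_].
    by rewrite inE => -[Ei _]; rewrite mem_set //= add0r.
  by rewrite andbT addr0.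
have [x [s [s0 homo_s xP xs]]] := @block_sequence R P 0%N exP.
have homo_s' : {homo s : i j / (i <= j)%N}.
  by apply: (homo_leq leqnn leq_trans) => k; exact/ltnW/homo_s.
pose A := [set i | exists k, (x k)`_i != 0].
have antiA i j : A i -> A j -> ~ prec i j.
  move=> [k xi] [l xj]; have [_ Ek Pk _] := xP k; have [_ El Pl _] := xP l.
  case: (ltngtP k l) => [kl|lk|kl].
  - have /andP[_ ik] := xs _ _ xi.
    by have [] := Pl j i xj (Ek _ xi) (leq_trans ik (homo_s' _ _ kl)).
  - have /andP[_ jl] := xs _ _ xj.
    by have [] := Pk i j xi (El _ xj) (leq_trans jl (homo_s' _ _ lk)).
  - by rewrite -kl in xj; have [[_ Ak] _ _ _] := xP k; exact: Ak.
(* Masking to the antichain [A] sends [tball] into [anti_ball], so [y] restricted to [A] is bounded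
   on [tball]. Its tails must then fall below the [e / 2] exceeded on every block. *)
have : tail_vanishes (@tball R) (fun i => \1_A i * y i).
  apply: tball_tail_vanishes; exists C => p Bp; rewrite -dot_pmask; apply: yC.
  split; first by apply: tball_pmask => // i; exact: indic_le1.
  move=> i j; rewrite !coef_pmask !mulf_eq0 !negb_or !indicE => /andP[+ _] /andP[+ _].
  case: (boolP (i \in A)) => [|_]; last by rewrite eqxx.
  rewrite inE => Ai _; case: (boolP (j \in A)) => [|_]; last by rewrite eqxx.
  by rewrite inE => Aj _; exact: antiA.
move=> /(_ _ (divr_gt0 e0 (ltr0Sn _ 1)))[N NP].
have [[Bx _] _ _] := xP N.
rewrite ltNge => /negP; apply.
rewrite (_ : dot _ _ = dot (fun i => \1_A i * y i) (x N)).
  apply: NP => // i iN; apply/eqP/negPn/negP => /xs /andP[sNi _].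
  have : (N <= s N)%N by elim: (N) => // n IH; apply: leq_ltn_trans IH (homo_s _ _ _).
  by lia.
by apply: dot_eq => i xi; rewrite indicE mem_set ?mul1r //; exists N.
Qed.

(** If the whole index set is bad, [good_step] yields a point with a bad set above it, and above
    each such point another one; iteration gives an infinite increasing sequence. *)
Lemma anti_ball_tail_vanishes y :
  (exists C, forall p, anti_ball p -> dot y p <= C) -> tail_vanishes anti_ball y.
Proof.
case: (prec_tree) => _ tr _ noinf yC.
suff : good y setT.
  move=> gT e /gT[N NP]; exists N => p Gp /NP - /(_ Gp).
  by rewrite (@dot_eq _ _ y) // => i _; rewrite indicE in_setT mul1r.
apply: good_step => // a0 _; rewrite setTI; apply: contrapT => bad0.
apply: noinf.
have /choice[g gP] : forall a, exists b, ~ good y (above a) ->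
    prec a b /\ ~ good y (above b).
  move=> a; have [?|bada] := pselect (good y (above a)); first by exists 0%N.
  apply: contrapT => /forallNP h; apply: bada; apply: good_step => // b ab.
  apply: contrapT => badb; apply: (h b) => _; split=> // gb.
  by apply: badb; apply: good_subset gb => j [].
exists (fun k => iter k g a0) => k.
suff : ~ good y (above (iter k g a0)) by move=> /gP[].
by elim: k => //= k /gP[].
Qed.

End AntichainSupports.

(** * Banach sequence spaces *)

(* A solid set [G] of finitely supported functionals; [seqsp G] consists of all the
   sequences on which it is bounded, so bounded completeness of the unit vector
   basis is the density of the finitely supported sequences. *)
Record norming_set (R : realType) := NormingSet {
  nset :> {poly R} -> Prop;
  nset_monomial : forall i, nset 'X^i;
  nset_coef : forall p i, nset p -> `|p`_i| <= 1;
  nset_pmask : forall (s : nat -> R) p,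
    (forall i, `|s i| <= 1) -> nset p -> nset (pmask s p)
}.

Definition bounded_on (R : realType) (G : norming_set R) : {pred nat -> R} :=
  fun y => `[< exists C, forall p, G p -> dot y p <= C >].

Record seqsp (R : realType) (G : norming_set R) := SeqSp {
  seqsp_val :> nat -> R;
  _ : seqsp_val \in bounded_on G
}.

(** * Banach space structure of the sequence spaces *)

Section SeqSpStructure.
Variables (R : realType) (G : norming_set R).

Lemma bounded_onP (y : nat -> R) :
  reflect (exists C, forall p, G p -> dot y p <= C) ((y : nat -> R) \in bounded_on G).
Proof. exact: asboolP. Qed.

Lemma pmask_sign (a : R) p : pmask (fun=> Num.sg a) p = Num.sg a *: p.
Proof. by apply/polyP => i; rewrite coef_pmask coefZ. Qed.

Lemma nset_sign (a : R) p : G p -> G (Num.sg a *: p).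
Proof.
rewrite -pmask_sign; apply: nset_pmask => _.
by rewrite normr_sg; case: (_ == _) => /=.
Qed.

Lemma nset_opp p : G p -> G (- p).
Proof. by move=> /(nset_sign (-1)); rewrite sgrN sgr1 scaleN1r. Qed.

Lemma dotNr (y : nat -> R) p : dot y (- p) = - dot y p.
Proof. by rewrite -scaleN1r dotZr mulN1r. Qed.

Lemma dot_scale (a : R) (y : nat -> R) p :
  dot ((a *: y) : nat -> R) p = `|a| * dot y (Num.sg a *: p).
Proof. by rewrite dotZr mulrCA mulrA -numEsg -dotZl. Qed.

Lemma bounded_on_submod : submod_closed (bounded_on G).
Proof.
split; first by apply/bounded_onP; exists 0 => p _; rewrite dot0l.
move=> a y z /bounded_onP[C yC] /bounded_onP[D zD]; apply/bounded_onP.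
exists (`|a| * C + D) => p Gp; rewrite dotDl dot_scale lerD ?zD //.
by rewrite ler_wpM2l // yC //; exact: nset_sign.
Qed.

HB.instance Definition _ := GRing.isSubmodClosed.Build R (nat -> R) (bounded_on G)
  bounded_on_submod.

HB.instance Definition _ := [isSub for @seqsp_val R G].
HB.instance Definition _ := [Choice of seqsp G by <:].
HB.instance Definition _ := [SubChoice_isSubLmodule of seqsp G by <:].

Implicit Types (x y : seqsp G) (p : {poly R}).

Lemma seqspD x y i : (x + y) i = x i + y i. Proof. by []. Qed.
Lemma seqspN x i : (- x) i = - x i. Proof. by []. Qed.
Lemma seqspZ (a : R) x i : (a *: x) i = a * x i. Proof. by []. Qed.
Lemma seqsp0 i : (0 : seqsp G) i = 0. Proof. by []. Qed.

Lemma seqsp_ext x y : (forall i, x i = y i) -> x = y.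
Proof. by move=> xy; apply/val_inj/funext. Qed.

(** The supremum is taken without absolute values because [G] is symmetric ([nset_opp]). *)
Let nm x := sup [set dot x p | p in nset G].

Let has_sup_nm x : has_sup [set dot x p | p in nset G].
Proof.
split; first by exists (dot x 'X^0), 'X^0 => //; exact: nset_monomial.
have /bounded_onP[C xC] := valP x.
by exists C => _ [p Gp <-]; exact: xC.
Qed.

Let nm_ge x p : G p -> dot x p <= nm x.
Proof. by move=> Gp; apply: (sup_upper_bound (has_sup_nm x)); exists p. Qed.

Let nm_le x c : (forall p, G p -> dot x p <= c) -> nm x <= c.
Proof.
move=> xc; apply: ge_sup; first exact: (has_sup_nm x).1.
by move=> _ [p Gp <-]; exact: xc.
Qed.

Let nmD x y : nm (x + y) <= nm x + nm y.
Proof. by apply: nm_le => p Gp; rewrite (dotDl x y) lerD ?nm_ge. Qed.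

Let nmZ_le (a : R) x : nm (a *: x) <= `|a| * nm x.
Proof.
apply: nm_le => p Gp; rewrite (dot_scale a x) ler_wpM2l // nm_ge //.
exact: nset_sign.
Qed.

Let nmZ (a : R) x : nm (a *: x) = `|a| * nm x.
Proof.
apply/le_anti; rewrite nmZ_le /=; have [->|a0] := eqVneq a 0.
  rewrite normr0 mul0r scale0r; apply: le_trans (nm_ge _ (nset_monomial G 0)).
  by rewrite dot_monomial.
rewrite -ler_pdivlMl ?normr_gt0 // -normfV; apply: le_trans (nmZ_le _ _).
by rewrite scalerA mulVf // scale1r.
Qed.

Let nm_coef x i : `|x i| <= nm x.
Proof.
have := nm_ge x (nset_monomial G i).
have := nm_ge x (nset_opp (nset_monomial G i)).
by rewrite dotNr dot_monomial ler_norml lerNl => -> ->.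
Qed.

Let nm0_eq0 x : nm x = 0 -> x = 0.
Proof.
move=> x0; apply: seqsp_ext => i; apply/eqP; rewrite -normr_le0.
by have := nm_coef x i; rewrite x0.
Qed.

HB.instance Definition _ := @Lmodule_isNormed.Build R (seqsp G) nm nmD nmZ nm0_eq0.

Lemma seqsp_norm_ge x p : G p -> dot x p <= `|x|. Proof. exact: nm_ge. Qed.

Lemma seqsp_norm_le x c : (forall p, G p -> dot x p <= c) -> `|x| <= c.
Proof. exact: nm_le. Qed.

Lemma seqsp_coef_le x i : `|x i| <= `|x|. Proof. exact: nm_coef. Qed.

Lemma cvg_dot T (F : set_system T) (FF : ProperFilter F) (x : T -> nat -> R)
    (y : nat -> R) p :
  (forall i, x t i @[t --> F] --> y i) -> dot (x t) p @[t --> F] --> dot y p.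
Proof.
move=> xy; apply: (@cvg_big R _ +%R) => [|i _]; first exact: add_continuous.
by apply: cvgMl; exact: xy.
Qed.

(** The limit is taken coordinatewise. Each [p] involves finitely many coordinates, so bounds
    uniform over [G] pass to the limit; this gives both membership in the space and convergence in
    norm. *)
Lemma seqsp_complete (F : set_system (seqsp G)) :
  ProperFilter F -> cauchy F -> cvg F.
Proof.
move=> FF /cauchyP Fc.
have cvg_coef i : cvg ((fun u : seqsp G => u i : R) @ F).
  apply: cauchy_cvg; apply/cauchyP => e e0.
  have [u Fu] := Fc e e0; exists (u i).
  rewrite /fmap /=; apply: filterS Fu => v /=; rewrite -!ball_normE /=; apply: le_lt_trans.
  exact: (seqsp_coef_le (u - v) i).
pose y i : R := lim ((fun u : seqsp G => u i : R) @ F).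
have cvg_y p (u : seqsp G) :
    (fun v : seqsp G => dot (fun i => u i - v i) p) @ F --> dot (fun i => u i - y i) p.
  apply: cvg_dot => i; apply: cvgB; first exact: cvg_cst.
  exact: cvg_coef.
have near_y e (u : seqsp G) : F (ball u e) ->
    forall p, G p -> dot (fun i => u i - y i) p <= e.
  move=> Fu p Gp; apply: (cvgr_to_le (cvg_y p u)); apply: filterS Fu => v.
  rewrite -ball_normE /= => /ltW; apply: le_trans.
  exact: (seqsp_norm_ge (u - v)).
have yb : (y : nat -> R) \in bounded_on G.
  have [u Fu] := Fc 1 ltr01.
  apply/bounded_onP; exists (1 + `|u|) => p Gp.
  rewrite (_ : dot y p = dot (fun i => u i - y i) (- p) + dot u p).
    by rewrite lerD ?seqsp_norm_ge // near_y //; exact: nset_opp.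
  by rewrite dotNr (dotDl u (- y)) dotNl; ring.
apply/cvg_ex; exists (SeqSp yb); apply/cvgrPdist_le => e e0.
have [u Fu] := Fc (e / 2) (divr_gt0 e0 (ltr0Sn _ 1)).
apply: filterS (Fu) => v; rewrite -ball_normE /= => /ltW uv.
rewrite distrC -(subrKA u) (splitr e).
apply: le_trans (ler_normD _ _) _; rewrite lerD //; first by rewrite distrC.
by apply: seqsp_norm_le => p Gp; exact: near_y.
Qed.

HB.instance Definition _ := Uniform_isComplete.Build (seqsp G) seqsp_complete.

End SeqSpStructure.

(** * Separability and the asymptotic game *)

Section SeqSpTheory.
Variables (R : realType) (G : norming_set R).
Implicit Types (x y : seqsp G) (p : {poly R}) (E : set nat).

Lemma seqsp_sumE n (x : nat -> seqsp G) j : (\sum_(i < n) x i) j = \sum_(i < n) x i j.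
Proof.
elim: n => [|n IH]; first by rewrite !big_ord0.
by rewrite !big_ord_recr /= -IH.
Qed.

Fact cutoff_subproof E x : (fun i => \1_E i * x i : R) \in bounded_on G.
Proof.
apply/bounded_onP; exists `|x| => p Gp; rewrite -dot_pmask.
by apply: seqsp_norm_ge; apply: nset_pmask => // i; exact: indic_le1.
Qed.

Definition cutoff E x : seqsp G := SeqSp (cutoff_subproof E x).

Lemma cutoffE E x i : cutoff E x i = \1_E i * x i. Proof. by []. Qed.

Lemma cutoff_in E x i : E i -> cutoff E x i = x i.
Proof. by move=> Ei; rewrite cutoffE indicE mem_set // mul1r. Qed.

Lemma cutoff_out E x i : ~ E i -> cutoff E x i = 0.
Proof. by move=> Ei; rewrite cutoffE indicE memNset // mul0r. Qed.

Lemma norm_cutoff_le E x : `|cutoff E x| <= `|x|.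
Proof.
apply: seqsp_norm_le => p Gp; rewrite -dot_pmask.
by apply: seqsp_norm_ge; apply: nset_pmask => // i; exact: indic_le1.
Qed.

Lemma norm_cutoff_sub E E' x : E `<=` E' -> `|cutoff E x| <= `|cutoff E' x|.
Proof.
move=> EE'; rewrite (_ : cutoff E x = cutoff E (cutoff E' x)).
  exact: norm_cutoff_le.
apply: seqsp_ext => i; have [Ei|nEi] := pselect (E i).
  by rewrite !cutoff_in //; exact: EE'.
by rewrite !cutoff_out.
Qed.

Fact delta_subproof (i : nat) : (fun j => (j == i)%:R : R) \in bounded_on G.
Proof.
apply/bounded_onP; exists 1 => p Gp.
have := dot_delta 1 i p; rewrite mul1r => ->.
by apply: le_trans (ler_norm _) _; exact: nset_coef Gp.
Qed.

Definition delta i : seqsp G := SeqSp (delta_subproof i).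

Lemma deltaE i j : delta i j = (j == i)%:R. Proof. by []. Qed.

Lemma norm_delta_le i : `|delta i| <= 1.
Proof.
apply: seqsp_norm_le => p Gp.
have := dot_delta 1 i p; rewrite mul1r => ->.
by apply: le_trans (ler_norm _) _; exact: nset_coef Gp.
Qed.

Lemma seqsp_split N x :
  x = cutoff [set i | (N <= i)%N] x + \sum_(i < N) x i *: delta i.
Proof.
apply: seqsp_ext => j; rewrite seqspD (seqsp_sumE N (fun i => x i *: delta i)).
case: (leqP N j) => Nj.
  rewrite cutoff_in // big1 ?addr0 // => i _.
  by rewrite seqspZ deltaE gtn_eqF ?mulr0 // (leq_trans (ltn_ord i)).
rewrite cutoff_out ?add0r; last by apply/negP; rewrite -ltnNge.
rewrite (bigD1 (Ordinal Nj)) // seqspZ deltaE eqxx mulr1.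
rewrite big1 => [|i ij]; first by rewrite /= addr0.
by rewrite seqspZ deltaE -[j]/(val (Ordinal Nj)) val_eqE eq_sym (negbTE ij) mulr0.
Qed.

Definition boundedly_complete := forall y : nat -> R,
  (exists C, forall p, G p -> dot y p <= C) -> tail_vanishes G y.

(** The upper estimate of T*: the constant 2 is dual to the factor 1/2 in [tsirelson_sum], and
    [n <= q 0] is the same admissibility condition. *)
Definition c0_blocks := forall n (x : nat -> seqsp G) (q : nat -> nat) c,
  0 <= c -> (n <= q 0)%N -> {homo q : i j / (i <= j)%N} ->
  (forall i, (i < n)%N -> `|x i| <= c) ->
  (forall i j, (i < n)%N -> x i j != 0 -> (q i <= j < q i.+1)%N) ->
  `|\sum_(i < n) x i| <= 2 * c.

Hypothesis Gbc : boundedly_complete.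

Lemma cutoff_tail x (e : R) : 0 < e -> exists N, forall M, (N <= M)%N ->
  `|cutoff [set i | (M <= i)%N] x| <= e.
Proof.
move=> e0; have /bounded_onP/Gbc/(_ e e0)[N NP] := valP x.
exists N => M NM; apply: seqsp_norm_le => p Gp; rewrite -dot_pmask.
apply: NP; first by apply: nset_pmask => // i; exact: indic_le1.
move=> i iN; rewrite coef_pmask indicE memNset ?mul0r //=.
by apply/negP; rewrite -ltnNge (leq_trans iN).
Qed.

Lemma seqsp_separable : separable_normed (seqsp G).
Proof.
pose rpt (s : seq rat) : seqsp G := \sum_(i < size s) (ratr s`_i : R) *: delta i.
exists (range rpt); split; first exact: sub_countable (card_image_le _ _) (countableP _).
move=> x e e0; have [N /(_ N (leqnn N)) xN] := cutoff_tail x (divr_gt0 e0 (ltr0Sn _ 1)).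
pose h := e / 2 / N.+1%:R.
have h0 : 0 < h by rewrite !divr_gt0.
have /choice[q qP] i : exists r : rat, `|x i - ratr r| < h.
  have [r] := @rat_in_itvoo R (x i - h) (x i + h) ltac:(lra).
  by rewrite in_itv /= => rh; exists r; rewrite distrC ltr_distl.
exists (rpt (mkseq q N)); first by exists (mkseq q N).
rewrite /norm_dist {1}(seqsp_split N x) /rpt size_mkseq.
rewrite -addrA -sumrB (splitr e); apply: le_lt_trans (ler_normD _ _) _.
apply: ler_ltD => //; apply: le_lt_trans (ler_norm_sum _ _ _) _.
apply: (@le_lt_trans _ _ (N%:R * h)); last first.
  rewrite /h mulrCA -[ltRHS]mulr1 ltr_pM2l ?divr_gt0 //.
  by rewrite ltr_pdivrMr // mul1r ltr_nat.
rewrite mulr_natl -[N in leRHS]card_ord -sumr_const; apply: ler_sum => i _.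
rewrite nth_mkseq // -scalerBl normrZ -[leRHS]mulr1.
by rewrite ler_pM // ?norm_delta_le // ltW.
Qed.

Lemma fin_codim_tail q : fin_codim_subspace [set x : seqsp G | forall i, (i < q)%N -> x i = 0].
Proof.
split.
  split=> // a x y x0 y0 i iq.
  by rewrite seqspD seqspZ x0 // y0 // mulr0 addr0.
split.
  move=> x xV i iq; apply/eqP/negPn/negP => xi.
  have [y [/= y0]] := xV _ (nbhsx_ballx x `|x i| ltac:(by rewrite normr_gt0)).
  rewrite -ball_normE /= ltNge => /negP; apply.
  by have := seqsp_coef_le (x - y) i; rewrite seqspD seqspN y0 // subr0.
exists q, (fun i => delta i) => x; exists (cutoff [set i | (q <= i)%N] x); split.
  by move=> i iq; rewrite cutoff_out //=; apply/negP; rewrite -ltnNge.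
by exists (fun i => x i); exact: seqsp_split.
Qed.

Hypothesis Gc0 : c0_blocks.

Lemma cutoff_lin E n (a : 'I_n -> R) (x : 'I_n -> seqsp G) :
  cutoff E (\sum_(i < n) a i *: x i) = \sum_(i < n) a i *: cutoff E (x i).
Proof.
apply: (big_rec2 (fun u v => cutoff E u = v)) => [|i u v _ <-].
  by apply: seqsp_ext => j; rewrite cutoffE !seqsp0 mulr0.
by apply: seqsp_ext => j; rewrite !(cutoffE, seqspD, seqspZ); ring.
Qed.

(** Each vector is a block plus a small tail. Above, the blocks contribute 2 by [c0_blocks] and the
    tails at most 1. Below, the cutoff to one block keeps [1 - eta] of its own vector, the others
    take away at most [n * eta], and [1 - eta - n * eta = 1 / 2]. *)
Lemma near_blocks_equiv_linf n (s : seq (seqsp G)) (q : nat -> nat) :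
  (size s <= n)%N -> (n <= q 0)%N -> {homo q : i j / (i <= j)%N} ->
  (forall i, (i < size s)%N -> [/\ `|nth 0 s i| = 1,
     forall j, (j < q i)%N -> nth 0 s i j = 0
     & `|cutoff [set j | (q i.+1 <= j)%N] (nth 0 s i)| <= (2 * n.+1%:R)^-1]) ->
  equiv_linf 6 s.
Proof.
set eta := (_)^-1 => sn nq homo_q sP.
have n0 : 0 < n.+1%:R :> R by [].
have eta0 : 0 < eta by rewrite invr_gt0 mulr_gt0.
have etaE : n%:R * eta + eta = 2^-1.
  have -> : n%:R * eta + eta = n.+1%:R * eta by rewrite -natr1; ring.
  by rewrite /eta invfM mulrCA mulfV ?mulr1 // gt_eqF.
exists 2, 3; do 3 (split; first lra).
move=> a; set M := \big[_/_]_(_ < _) _.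
have aM i : `|a i| <= M by exact: le_bigmax.
have M0 : 0 <= M by exact: bigmax_ge_id.
pose block i := [set j | (q i <= j < q i.+1)%N].
have split_s (i : 'I_(size s)) : nth 0 s i = cutoff (block i) (nth 0 s i) +
    cutoff [set j | (q i.+1 <= j)%N] (nth 0 s i).
  have [_ s0 _] := sP i (ltn_ord i).
  apply: seqsp_ext => j; rewrite seqspD !cutoffE !indicE.
  case: (ltnP j (q i)) => [jq|qj]; first by rewrite s0 // !mulr0 addr0.
  case: (ltnP j (q i.+1)) => jq'.
    rewrite mem_set /block /= ?qj ?jq' // mul1r memNset ?mul0r ?addr0 //=.
    by apply/negP; rewrite -ltnNge.
  rewrite memNset ?mul0r ?add0r ?mem_set ?mul1r //= /block /=.
  by apply/negP; rewrite negb_and -!ltnNge ltnS jq' orbT.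
have sum_le (u : 'I_(size s) -> seqsp G) : (forall i, `|u i| <= eta) ->
    `|\sum_i a i *: u i| <= n%:R * eta * M.
  move=> ue; apply: le_trans (ler_norm_sum _ _ _) _.
  apply: (@le_trans _ _ ((size s)%:R * (eta * M))); last first.
    by rewrite -mulrA ler_wpM2r ?ler_nat // mulr_ge0 // ltW.
  rewrite mulr_natl -[X in _ *+ X]card_ord -sumr_const; apply: ler_sum => i _.
  by rewrite normrZ mulrC ler_pM.
split.
  rewrite ler_pdivrMl //.
  have eta1 : 0 < 1 - eta.
    have : 0 <= n%:R * eta by rewrite mulr_ge0 // ltW.
    by move: etaE; lra.
  set S := \sum_(_ < _) _.
  suff : M <= (`|S| + n%:R * eta * M) / (1 - eta).
    rewrite ler_pdivlMr; last exact: eta1.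
    have -> : n%:R * eta = 2^-1 - eta by lra.
    by move=> H; lra.
  apply: bigmax_le => [|i _].
    by rewrite divr_ge0 ?(ltW eta1) // addr_ge0 // !mulr_ge0 // ltW.
  rewrite ler_pdivlMr //; apply: le_trans (lerD (norm_cutoff_le (block i) S) (lexx _)).
  have [si1 _ si_tail] := sP i (ltn_ord i).
  have block_ge : 1 - eta <= `|cutoff (block i) (nth 0 s i)|.
    rewrite lerBlDr -si1 {1}(split_s i); apply: le_trans (ler_normD _ _) _.
    by rewrite lerD2l.
  have -> : cutoff (block i) S = a i *: cutoff (block i) (nth 0 s i) +
      \sum_j a j *: (if j == i then 0 else cutoff (block i) (nth 0 s j)).
    rewrite cutoff_lin (bigD1 i) //= [in RHS](bigD1 i) //= eqxx scaler0 add0r.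
    by congr (_ + _); apply: eq_bigr => j /negbTE ->.
  rewrite -lerBlDr; apply: le_trans (lerB_normD _ _); rewrite lerB //.
    by rewrite normrZ ler_wpM2l.
  apply: sum_le => j; case: eqP => [_|/eqP ji]; first by rewrite normr0 ltW.
  have [_ sj0 sj_tail] := sP j (ltn_ord j).
  (* On block [i] an earlier vector shows only its tail, and a later one vanishes. *)
  move: ji; rewrite neq_ltn => /orP[ji|ij].
    apply: le_trans sj_tail; apply: norm_cutoff_sub => k /= /andP[+ _].
    by apply: leq_trans; exact: homo_q.
  rewrite (_ : cutoff _ _ = 0) ?normr0 ?ltW //.
  apply: seqsp_ext => k; rewrite seqsp0.
  have [bk|nk] := pselect (block i k); last by rewrite cutoff_out.
  case/andP: bk => _ ki.
  by rewrite cutoffE sj0 ?mulr0 // (leq_trans ki) // homo_q.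
(* Extension by 0, since [c0_blocks] speaks of families indexed by all naturals. *)
pose a' i : R := oapp a 0 (insub i).
have a'E (i : 'I_(size s)) : a' i = a i by rewrite /a' valK.
rewrite (eq_bigr (fun i : 'I_(size s) => a' i *: cutoff (block i) (nth 0 s i) +
    a i *: cutoff [set j | (q i.+1 <= j)%N] (nth 0 s i))); last first.
  by move=> i _; rewrite a'E -scalerDr -split_s.
rewrite big_split /=; apply: le_trans (ler_normD _ _) _.
have -> : 3 * M = 2 * M + M by ring.
apply: lerD.
  apply: (@Gc0 _ (fun i => a' i *: cutoff (block i) (nth 0 s i)) q) => //.
  - exact: leq_trans nq.
  - move=> i si; have [si1 _ _] := sP i si.
    have := a'E (Ordinal si) => /= ->; rewrite normrZ -[leRHS]mulr1 ler_pM //.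
    by rewrite -si1 norm_cutoff_le.
  - move=> i j si; rewrite seqspZ mulf_eq0 negb_or => /andP[_].
    by have [//|/cutoff_out ->] := pselect (block i j); rewrite eqxx.
apply: (@le_trans _ _ (n%:R * eta * M)).
  by apply: sum_le => i; have [] := sP i (ltn_ord i).
by rewrite -[leRHS]mul1r ler_wpM2r //; lra.
Qed.

(** Strategy in the game: start with the vectors vanishing below [n], and after each move pass to
    the tail subspace beyond which the vector just played has norm at most [(2 * n.+1)^-1]. *)
Lemma seqsp_asymptotic_c0 : asymptotic_c0 (seqsp G).
Proof.
exists 6; split; first lra.
move=> n.
suff H m (s : seq (seqsp G)) (q : nat -> nat) :
  (size s + m = n)%N -> (n <= q 0)%N -> {homo q : i j / (i <= j)%N} ->
  (forall i, (i < size s)%N -> [/\ `|nth 0 s i| = 1,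
     forall j, (j < q i)%N -> nth 0 s i j = 0
     & `|cutoff [set j | (q i.+1 <= j)%N] (nth 0 s i)| <= (2 * n.+1%:R)^-1]) ->
  asym_game 6 m s.
  by apply: (H _ _ (fun=> n)).
elim: m s q => [|m IH] s q /= sn nq homo_q sP.
  by apply: (@near_blocks_equiv_linf n s q) => //; rewrite -sn leq_addr.
exists [set x : seqsp G | forall i, (i < q (size s))%N -> x i = 0].
split; first exact: fin_codim_tail.
move=> x x0 x1.
have [N NP] := @cutoff_tail x (2 * n.+1%:R)^-1 ltac:(by rewrite invr_gt0 mulr_gt0).
(* The starting points already used are kept; the next one, past [N], also fills all later indices
   until it is revised. *)
pose q' i := if (i <= size s)%N then q i else maxn N (q (size s)).
apply: (IH _ q') => //.
- by rewrite size_rcons addSnnS.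
- apply: (homo_leq leqnn leq_trans) => i; rewrite /q'.
  case: (ltngtP i (size s)) => [||->] //; first by rewrite homo_q.
  by rewrite leq_maxr.
move=> i; rewrite size_rcons ltnS leq_eqVlt nth_rcons /q' => /predU1P[->|is_].
  rewrite ltnn eqxx leqnn; split=> //.
  by apply: NP; rewrite leq_maxl.
by rewrite is_ ltnW //; exact: sP.
Qed.

End SeqSpTheory.

(** * Continuous linear functionals *)

Section DualElements.
Variables (R : realType) (X : completeNormedModType R).
Implicit Types (x y : X) (f : X -> R).

Lemma dual_eltD f x y : dual_elt f -> f (x + y) = f x + f y.
Proof. by move=> [flin _]; rewrite -[x in LHS]scale1r flin mul1r. Qed.

Lemma dual_elt0 f : dual_elt f -> f 0 = 0.
Proof. by move=> df; have := dual_eltD 0 0 df; rewrite addr0; lra. Qed.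

Lemma dual_eltZ f (a : R) x : dual_elt f -> f (a *: x) = a * f x.
Proof. by move=> df; have [+ _] := df => /(_ a x 0); rewrite dual_elt0 // !addr0. Qed.

Lemma dual_elt_sum f n (x : nat -> X) : dual_elt f ->
  f (\sum_(i < n) x i) = \sum_(i < n) f (x i).
Proof.
move=> df; elim: n => [|n IH]; first by rewrite !big_ord0 dual_elt0.
by rewrite !big_ord_recr /= dual_eltD // IH.
Qed.

Lemma dual_eltN f x : dual_elt f -> f (- x) = - f x.
Proof. by move=> df; rewrite -scaleN1r dual_eltZ // mulN1r. Qed.

Lemma dual_elt_bounded f : dual_elt f -> exists2 C, 0 < C & forall x, `|f x| <= C * `|x|.
Proof.
move=> df; have [_ fcont] := df.
have /cvgrPdist_lt/(_ 1 ltr01) := fcont 0.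
rewrite dual_elt0 // => /nbhs_ballP[d /= d0 dP].
have d20 : 0 < 2 / d by rewrite divr_gt0.
exists (2 / d) => // x.
have [->|x0] := eqVneq x 0; first by rewrite dual_elt0 // !normr0 mulr0.
have nx0 : 0 < `|x| by rewrite normr_gt0.
pose a := d / 2 / `|x|.
have a0 : 0 < a by rewrite !divr_gt0.
have /dP /= : ball 0 d (a *: x).
  rewrite -ball_normE /= sub0r normrN normrZ gtr0_norm // /a divfK ?gt_eqF //.
  by rewrite ltr_pdivrMr // ltr_pMr // ltr1n.
rewrite sub0r normrN dual_eltZ // normrM gtr0_norm // -ltr_pdivlMl // mulr1 => /ltW.
by move/le_trans; apply; rewrite /a !invfM !invrK; lra.
Qed.

Lemma bounded_dual_elt f C : (forall (a : R) x y, f (a *: x + y) = a * f x + f y) ->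
  (forall x, `|f x| <= C * `|x|) -> dual_elt f.
Proof.
move=> flin fC; split=> // x; apply/cvgrPdist_le => e e0.
have C0 : 0 < `|C| + 1 by rewrite ltr_wpDl.
apply/nbhs_ballP; exists ((`|C| + 1)^-1 * e); first by rewrite /= mulr_gt0 // invr_gt0.
move=> y; rewrite -ball_normE /= => /ltW xy.
have -> : f x - f y = f (x - y).
  by have := flin (-1) y x; rewrite scaleN1r addrC => ->; ring.
apply: le_trans (fC _) _; apply: (@le_trans _ _ ((`|C| + 1) * `|x - y|)).
  by rewrite ler_wpM2r // (le_trans (ler_norm _)) // lerDl.
by rewrite -ler_pdivlMl.
Qed.

End DualElements.

(** * The shrinking property and reflexivity *)

Section Reflexivity.
Variables (R : realType) (G : norming_set R).
Hypotheses (Gbc : boundedly_complete G) (Gc0 : c0_blocks G).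
Implicit Types (x y : seqsp G) (p : {poly R}) (f : seqsp G -> R).

(* [n] far away almost disjoint unit vectors have a sum of norm at most [2], so
   a functional cannot be larger than [e] on all of them. *)
Lemma functional_tail f (e : R) : dual_elt f -> 0 < e ->
  exists N, forall x, (forall i, (i < N)%N -> x i = 0) -> `|f x| <= e * `|x|.
Proof.
move=> df e0; have [C C0 fC] := dual_elt_bounded df.
apply/not_existsP => big_f.
have big_block N : exists x M, [/\ `|x| <= 1,
    forall j, x j != 0 -> (N <= j < M)%N & e < f x].
  have /existsNP[x /not_implyP[x0 /negP]] := big_f N; rewrite -ltNge => fx.
  have nx0 : 0 < `|x|.
    rewrite normr_gt0; apply: contraTneq fx => ->.
    by rewrite (dual_elt0 df) (@normr0 R R) -leNgt mulr_ge0 // ltW.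
  pose u := (Num.sg (f x) / `|x|) *: x.
  have u1 : `|u| <= 1.
    rewrite normrZ normrM normfV normr_id divfK ?gt_eqF // normr_sg.
    by case: (_ != _).
  have fu : e < f u by rewrite dual_eltZ // mulrAC -normrEsg ltr_pdivlMr.
  (* The strict gap [f u - e] pays for cutting [u] to finite support: the removed tail costs at most
     half of it. *)
  have h0 : 0 < (f u - e) / (2 * C) by rewrite divr_gt0 ?mulr_gt0 // subr_gt0.
  have [M /(_ M (leqnn M)) uM] := cutoff_tail Gbc u h0.
  exists (cutoff [set i | (i < M)%N] u), M; split.
  - exact: le_trans (norm_cutoff_le _ _) _.
  - move=> j; have [jM|nj] := pselect ([set i | (i < M)%N] j); last first.
      by rewrite cutoff_out // eqxx.
    rewrite cutoff_in // => uj; rewrite jM andbT leqNgt; apply: contra uj => jN.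
    by rewrite /u seqspZ x0 // mulr0.
  have -> : cutoff [set i | (i < M)%N] u = u - cutoff [set i | (M <= i)%N] u.
    apply: seqsp_ext => j; rewrite seqspD seqspN; case: (ltnP j M) => jM.
      rewrite cutoff_in // cutoff_out ?subr0 //=.
      by apply/negP; rewrite -ltnNge.
    rewrite cutoff_out; last by rewrite /=; apply/negP; rewrite -leqNgt.
    by rewrite cutoff_in // subrr.
  rewrite dual_eltD // dual_eltN //.
  have := fC (cutoff [set i | (M <= i)%N] u).
  have : C * `|cutoff [set i | (M <= i)%N] u| <= (f u - e) / 2.
    by rewrite mulrC -ler_pdivlMr // -mulrA -invfM.
  have := ler_norm (f (cutoff [set i | (M <= i)%N] u)).
  lra.
have {big_block}/choice[g /choice[h gP]] := big_block.
(* On the sum of [n] blocks, of norm at most 2, [f] is at most [2 * C] but at least [n * e]; this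
   [n] makes the two incompatible. *)
pose n := (Num.trunc (2 * C / e)).+1.
have n0 : 2 * C < n%:R * e.
  by rewrite -ltr_pdivrMr // /n truncnS_gt.
pose q := fix q k := if k is k'.+1 then maxn (q k') (h (q k')) else n.
pose x k := g (q k).
have homo_q : {homo q : i j / (i <= j)%N}.
  by apply: (homo_leq leqnn leq_trans) => k; rewrite /= leq_maxl.
have sum2 : `|\sum_(i < n) x i| <= 2 * 1.
  apply: (@Gc0 _ x q) => // [i _|i j _]; first by have [] := gP (q i).
  have [_ xq _] := gP (q i) => /xq /andP[-> /= jq].
  by rewrite (leq_trans jq) // leq_maxr.
have := fC (\sum_(i < n) x i).
have : n%:R * e <= f (\sum_(i < n) x i).
  rewrite dual_elt_sum // mulr_natl -[X in _ *+ X]card_ord -sumr_const.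
  by apply: ler_sum => i _; have [_ _ /ltW] := gP (q i).
have := ler_norm (f (\sum_(i < n) x i)).
have : C * `|\sum_(i < n) x i| <= C * 2 by rewrite ler_pM2l //; lra.
lra.
Qed.

Lemma dual_coef i : dual_elt (fun x => x i).
Proof. by apply: (@bounded_dual_elt R (seqsp G) _ 1) => // x; rewrite mul1r; exact: seqsp_coef_le. Qed.

Lemma dual_comb n (c : nat -> R) : dual_elt (fun x => \sum_(i < n) c i * x i).
Proof.
apply: (@bounded_dual_elt R (seqsp G) _ (\sum_(i < n) `|c i|)) => [a x y|x].
  rewrite mulr_sumr -big_split /=; apply: eq_bigr => i _.
  by change (c i * (a * x i + y i) = a * (c i * x i) + c i * y i); ring.
rewrite mulr_suml; apply: le_trans (ler_norm_sum _ _ _) _; apply: ler_sum => i _.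
by rewrite normrM ler_wpM2l // seqsp_coef_le.
Qed.

Lemma bidual_comb Phi n (c : nat -> R) : bidual_elt Phi ->
  Phi (fun x => \sum_(i < n) c i * x i) = \sum_(i < n) c i * Phi (fun x => x i).
Proof.
move=> [Plin _]; elim: n => [|n IH].
  rewrite big_ord0; have := Plin 1 _ _ (dual_comb 0 c) (dual_comb 0 c).
  have -> : (fun x => 1 * (\sum_(i < 0) c i * x i) + \sum_(i < 0) c i * x i) =
     (fun x => \sum_(i < 0) c i * x i).
    by apply/funext => x; rewrite !big_ord0 mulr0 addr0.
  by lra.
rewrite big_ord_recr /= -IH addrC -Plin; [|exact: dual_coef|exact: dual_comb].
by congr Phi; apply/funext => x; rewrite big_ord_recr /= addrC.
Qed.

(** The values of [Phi] on the coordinate functionals form a sequence bounded on [G], hence a vector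
    [xa] of the space. [Phi] is evaluation at [xa] on finite combinations of coordinates, and these
    approximate every functional in norm by [functional_tail]. *)
Lemma seqsp_reflexive : reflexive_space (seqsp G).
Proof.
move=> Phi dPhi; have [Plin [K PK]] := dPhi.
pose a i := Phi (fun x => x i).
have a_bounded : a \in bounded_on G.
  apply/bounded_onP; exists K => p Gp.
  have -> : dot a p = Phi (fun x => \sum_(i < size p) p`_i * x i).
    by rewrite bidual_comb //; apply: eq_bigr => i _; rewrite mulrC.
  have := PK _ 1 (dual_comb (size p) (nth 0 p)) ler01; rewrite mulr1 => PK1.
  apply: le_trans (ler_norm _) (PK1 _) => x; rewrite mul1r.
  rewrite (_ : \sum_(_ < _) _ = dot x p); last first.
    by apply: eq_bigr => i _; rewrite mulrC.
  rewrite ler_norml seqsp_norm_ge // andbT lerNl -dotNr.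
  by apply: seqsp_norm_ge; exact: nset_opp.
pose xa : seqsp G := SeqSp a_bounded.
exists xa => f df; apply/eqP; rewrite -subr_eq0 -normr_le0.
apply/ler_addgt0Pr => d d0; rewrite add0r.
(* On the tail part of [f], [Phi] and evaluation at [xa] together amount to at most
   [(|K| + |xa|) * d / D]. *)
pose D := `|K| + `|xa| + 1.
have D0 : 0 < D by rewrite ltr_wpDl // addr_ge0.
have [N fN] := functional_tail df (divr_gt0 d0 D0).
pose fN' x := \sum_(i < N) f (delta G i) * x i.
pose t x := cutoff [set i | (N <= i)%N] x.
have ft x : f x = f (t x) + fN' x.
  rewrite [in LHS](seqsp_split N x) dual_eltD //.
  rewrite (dual_elt_sum N (fun i => x i *: delta G i)) //.
  by congr (_ + _); apply: eq_bigr => i _; rewrite dual_eltZ // mulrC.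
have tN x : `|f (t x)| <= d / D * `|x|.
  apply: le_trans (fN _ _) _ => [i iN|].
    by rewrite cutoff_out //=; apply/negP; rewrite -ltnNge.
  by rewrite ler_wpM2l ?norm_cutoff_le // ltW // divr_gt0.
have dft : dual_elt (fun x => f (t x)).
  apply: (@bounded_dual_elt R (seqsp G) _ (d / D)) => // b x y.
  rewrite -dual_eltZ // -dual_eltD //; congr f; apply: seqsp_ext => i.
  by rewrite !(cutoffE, seqspD, seqspZ); ring.
have PhiE : Phi f = Phi (fun x => f (t x)) + fN' xa.
  rewrite (_ : fN' xa = Phi fN'); last first.
    exact/esym/(bidual_comb N (fun i => f (delta G i)) dPhi).
  rewrite -[X in _ = X + _]mul1r -(Plin 1 _ fN' dft (dual_comb N (fun i => f (delta G i)))).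
  by congr Phi; apply/funext => x; rewrite mul1r.
rewrite PhiE (ft xa) opprD addrACA subrr addr0.
apply: le_trans (ler_normB _ _) _.
have H1 : `|Phi (fun x => f (t x))| <= K * (d / D).
  by apply: PK => //; rewrite ltW // divr_gt0.
apply: le_trans (lerD H1 (tN _)) _.
have dD0 : 0 < d / D by rewrite divr_gt0.
rewrite mulrC -mulrDr.
have dDD : d / D * D = d by rewrite divfK // gt_eqF.
rewrite -[leRHS]dDD ler_pM2l // /D.
by have := ler_norm K; lra.
Qed.

End Reflexivity.

(** * The antichain space *)

Section AntichainSpace.
Variables (R : realType) (prec : nat -> nat -> Prop).
Hypothesis prec_tree : tree_like prec.
Implicit Types (p : {poly R}).

Lemma anti_ball_coef p i : anti_ball prec p -> `|p`_i| <= 1.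
Proof. by move=> [/tball_coef]. Qed.

Definition anti_norming : norming_set R :=
  NormingSet (anti_ball_monomial R prec_tree) anti_ball_coef (@anti_ball_pmask R prec).

Notation X := (seqsp anti_norming).

Lemma anti_bc : boundedly_complete anti_norming.
Proof. exact: anti_ball_tail_vanishes. Qed.

(** [t] is any positive bound for the Tsirelson norm of [p]; division by it puts [p] into the
    norming set. *)
Lemma tsirelson_homogeneous (x : X) p (t : R) : 0 < t -> antichain_supp prec p ->
  (forall w, tsirelson w -> dot w p <= t) -> dot x p <= `|x| * t.
Proof.
move=> t0 Ap pt; rewrite mulrC -ler_pdivrMl // -dotZr; apply: seqsp_norm_ge; split.
  by move=> w Ww; rewrite dotZr ler_pdivrMl // mulr1 pt.
move=> i j; rewrite !coefZ !mulf_eq0 !negb_or => /andP[_ ?] /andP[_ ?].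
exact: Ap.
Qed.

(** [sup (T i)] is the Tsirelson norm of the piece of [p] on block [i]. As [n <= q 0], nearly
    norming functionals of the pieces combine into one [tsirelson_sum], so these norms add up to at
    most 2 up to an error; each [x i] is at most [c] times the norm of its piece. *)
Lemma anti_c0 : c0_blocks anti_norming.
Proof.
move=> n x q c c0 nq homo_q xc xq; apply: seqsp_norm_le => p [Bp Ap].
pose E i := [set j | (q i <= j < q i.+1)%N].
pose pE i := pmask \1_(E i) p.
have BpE i : tball (pE i) by apply: tball_pmask => // j; exact: indic_le1.
pose T i := [set dot w (pE i) | w in @tsirelson R].
have supT i : has_sup (T i).
  split; first by exists (dot (fun=> 0) (pE i)), (fun=> 0) => //; exact: tsirelson0.
  by exists 1 => _ [w Ww <-]; exact: BpE.
have T0 i : 0 <= sup (T i).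
  apply: sup_upper_bound => //; exists (fun=> 0); [exact: tsirelson0|exact: dot0l].
have dotE : dot (\sum_(i < n) x i : X) p = \sum_(i < n) dot (x i) (pE i).
  rewrite -[RHS]/(\sum_(i < n) dot (x i) (pmask \1_(E i) p)).
  under [RHS]eq_bigr do rewrite dot_pmask.
  rewrite -(dot_suml n (fun i j => \1_(E i) j * x i j)); apply: dot_eq => j _.
  rewrite seqsp_sumE; apply: eq_bigr => i _.
  have [->|/(xq _ _ (ltn_ord i)) Ej] := eqVneq (x i j) 0; first by rewrite mulr0.
  by rewrite indicE mem_set // mul1r.
rewrite dotE; apply/ler_addgt0Pr => d d0.
(* The error enters twice for each of the [n] blocks, in all [2 * n * c * e <= d]. *)
pose e := d / (2 * n%:R * c + 1).
have D0 : 0 < 2 * n%:R * c + 1 by rewrite ltr_wpDl // !mulr_ge0.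
have e0 : 0 < e by rewrite divr_gt0.
have /choice[w wP] i : exists w, tsirelson w /\ sup (T i) - e < dot w (pE i).
  by have [_ [w Ww <-] ?] := sup_adherent e0 (supT i); exists w.
have sumT : \sum_(i < n) sup (T i) <= 2 + n%:R * e.
  have : dot (fun j => 2^-1 * \sum_(i < n) (\1_(E i) j * w i j)) p <= 1.
    apply: Bp; apply: (@tsirelson_sum R n (fun i j => \1_(E i) j * w i j) q) => //.
      move=> i _; apply: tsirelson_solid; [exact: indic_le1|exact: (wP i).1].
    move=> i j _; rewrite mulf_eq0 negb_or indicE => /andP[+ _].
    by case: (boolP (j \in E i)); [rewrite inE|rewrite eqxx].
  rewrite dotZl (dot_suml n (fun i j => \1_(E i) j * w i j)) => H.
  have : \sum_(i < n) (sup (T i) - e) <= \sum_(i < n) dot (fun j => \1_(E i) j * w i j) p.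
    apply: ler_sum => i _; rewrite -dot_pmask; exact/ltW/(wP i).2.
  rewrite sumrB sumr_const card_ord -mulr_natl.
  lra.
apply: (@le_trans _ _ (\sum_(i < n) c * (sup (T i) + e))).
  apply: ler_sum => i _.
  have t0 : 0 < sup (T i) + e by rewrite ltr_wpDl.
  apply: le_trans (@tsirelson_homogeneous (x i) (pE i) _ t0 _ _) _.
  - move=> j k; rewrite !coef_pmask !mulf_eq0 !negb_or => /andP[_ ?] /andP[_ ?].
    exact: Ap.
  - move=> v Wv; apply: (@le_trans _ _ (sup (T i))); last by rewrite lerDl ltW.
    by apply: sup_upper_bound => //; exists v.
  by rewrite ler_wpM2r ?(ltW t0) // xc.
rewrite -mulr_sumr big_split /= sumr_const card_ord -mulr_natl.
apply: (@le_trans _ _ (c * (2 + n%:R * e + n%:R * e))).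
  by apply: ler_wpM2l => //; lra.
have <- : e * (2 * n%:R * c + 1) = d by rewrite divfK // gt_eqF.
by nra.
Qed.

(** An antichain meets a chain in at most one point, so at most one term survives against each
    [p]. *)
Lemma norm_chain_le n (a : 'I_n -> R) (b : nat -> nat) (l : R) : 0 <= l ->
  (forall i j, (i < j)%N -> (j < n)%N -> prec (b i) (b j)) ->
  (forall i, `|a i| <= l) -> `|\sum_(i < n) a i *: delta anti_norming (b i)| <= l.
Proof.
move=> l0 bchain al; apply: seqsp_norm_le => p Gp.
have -> : dot (\sum_(i < n) a i *: delta anti_norming (b i) : X) p =
    \sum_(i < n) a i * p`_(b i).
  have dotD (u v : X) : dot (u + v : X) p = dot u p + dot v p := dotDl u v p.
  apply: (big_rec2 (fun (u : X) v => dot u p = v)) => [|i u v _ <-]; first exact: dot0l.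
  rewrite dotD; congr (_ + _).
  rewrite (dotZl (a i) (delta anti_norming (b i))); congr (_ * _).
  by have := dot_delta 1 (b i) p; rewrite mul1r.
have [/existsP[i pi]|] := boolP [exists i : 'I_n, p`_(b i) != 0]; last first.
  rewrite negb_exists => /forallP p0; rewrite big1 // => i _.
  by have := p0 i; rewrite negbK => /eqP ->; rewrite mulr0.
rewrite (bigD1 i) //= big1 ?addr0.
  apply: le_trans (ler_norm _) _; rewrite normrM -[leRHS]mulr1 ler_pM //.
  exact: anti_ball_coef Gp.
move=> j ji; apply/eqP; rewrite mulf_eq0; apply/orP; right; apply/negPn/negP => pj.
have [_ Ap] := Gp; move: ji; rewrite neq_ltn => /orP[ji|ij].
  exact: Ap pj pi (bchain _ _ ji (ltn_ord i)).
exact: Ap pi pj (bchain _ _ ij (ltn_ord j)).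
Qed.

Lemma chain_coef n (a : 'I_n -> R) (b : nat -> nat) (i : 'I_n) : injective b ->
  (\sum_(k < n) a k *: delta anti_norming (b k) : X) (b i) = a i.
Proof.
move=> b_inj.
have -> : (\sum_(k < n) a k *: delta anti_norming (b k) : X) (b i) =
    \sum_(k < n) a k * (b i == b k)%:R.
  by apply: (big_rec2 (fun (u : X) v => u (b i) = v)) => // k u v _ <-.
rewrite (bigD1 i) //= eqxx mulr1 big1 ?addr0 // => k ki.
by rewrite (inj_eq b_inj) eq_sym val_eqE (negbTE ki) mulr0.
Qed.

End AntichainSpace.

(** * Finitely supported coordinates on a metric space *)

Lemma ex_nat_ge (R : realType) (x : R) : exists n : nat, x <= n%:R.
Proof. by exists (Num.trunc x).+1; exact/ltW/truncnS_gt. Qed.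

Section Metric.
Variables (R : realType) (N : metric_space R).
Implicit Types (x y : N).
Notation d := (@ms_dist R N).

Lemma ms_dist_ge0 x y : 0 <= d x y.
Proof.
by have := ms_dist_triangle x y x; rewrite ms_dist_self (ms_dist_sym y x); lra.
Qed.

Lemma dense_sequence (x0 : N) : separable_ms N -> exists z : nat -> N,
  forall x (e : R), 0 < e -> exists k, d x (z k) < e.
Proof.
move=> [S [/countable_injP[g g_inj] Sd]].
(* Numbers that are not codes of points of [S] receive the default [x0]. *)
have /choice[z zP] n : exists s, forall s', S s' -> g s' = n -> s = s'.
  have [[s' [Ss' <-]]|no_s] := pselect (exists s', S s' /\ g s' = n).
    by exists s' => s'' Ss'' gs; apply: g_inj => //; exact: mem_set.
  by exists x0 => s' Ss' gs'; case: no_s; exists s'.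
exists z => x e /(Sd x)[s Ss xs]; exists (g s).
by rewrite (zP _ s).
Qed.

Variable z : nat -> N.

(** A coordinate in the style of Aharoni: for [m = k] it vanishes outside the [3 * r]-ball of [z k]
    and on the [r]-balls of the earlier points, and equals [r] where [z k] is the first point within
    [2 * r]. The separate [m] allows induction. *)
Fixpoint bump_below (r : R) k m x : R :=
  if m is m'.+1 then Num.min (bump_below r k m' x) (Num.max 0 (d x (z m') - r))
  else Num.min r (Num.max 0 (3 * r - d x (z k))).

Definition bump (r : R) k x := bump_below r k k x.

Lemma dist_min_le (a b a' b' l : R) : `|a - a'| <= l -> `|b - b'| <= l ->
  `|Num.min a b - Num.min a' b'| <= l.
Proof.
rewrite !ler_distl !minElt => /andP[? ?] /andP[? ?].
by apply/andP; split; do 2 (case: ltP => ?); lra.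
Qed.

Lemma dist_max_le (a b a' b' l : R) : `|a - a'| <= l -> `|b - b'| <= l ->
  `|Num.max a b - Num.max a' b'| <= l.
Proof.
rewrite !ler_distl !maxElt => /andP[? ?] /andP[? ?].
by apply/andP; split; do 2 (case: ltP => ?); lra.
Qed.

Lemma dist_dist_le x y w : `|d x w - d y w| <= d x y.
Proof.
rewrite ler_distl; have := ms_dist_triangle x y w; have := ms_dist_triangle y x w.
by rewrite (ms_dist_sym y x) => ? ?; apply/andP; split; lra.
Qed.

Lemma bump_lip r k x y : `|bump r k x - bump r k y| <= d x y.
Proof.
have d0 := ms_dist_ge0 x y.
rewrite /bump; elim: {2 4}k => /= [|m IH]; apply: dist_min_le => //.
- by rewrite subrr normr0.
- apply: dist_max_le; first by rewrite subrr normr0.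
  by rewrite opprB addrC addrA subrK distrC; exact: dist_dist_le.
- apply: dist_max_le; first by rewrite subrr normr0.
  by rewrite opprB addrA subrK; exact: dist_dist_le.
Qed.

Lemma bump_ge0 r k x : 0 <= r -> 0 <= bump r k x.
Proof.
by move=> r0; rewrite /bump; elim: {2}k => /= [|m IH]; rewrite le_min ?r0 ?IH le_max lexx.
Qed.

Lemma bump_eq0_near r k j x : 0 <= r -> (j < k)%N -> d x (z j) <= r -> bump r k x = 0.
Proof.
move=> r0 jk xj; apply/le_anti; rewrite bump_ge0 // andbT.
suff H m : (j < m)%N -> bump_below r k m x <= 0 by exact: H.
elim: m => //= m IH; rewrite ltnS leq_eqVlt ge_min => /predU1P[<-|jm].
  by rewrite orbC ge_max lexx subr_le0 xj.
by rewrite IH.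
Qed.

Lemma bump_eq0_far r k x : 0 <= r -> 3 * r <= d x (z k) -> bump r k x = 0.
Proof.
move=> r0 xk; apply/le_anti; rewrite bump_ge0 // andbT /bump.
elim: {2}k => /= [|m IH]; rewrite ge_min ?IH //.
by rewrite orbC ge_max lexx subr_le0 xk.
Qed.

Lemma bump_full r k x : d x (z k) <= 2 * r -> (forall j, (j < k)%N -> 2 * r <= d x (z j)) ->
  bump r k x = r.
Proof.
move=> xk xj; suff H m : (m <= k)%N -> bump_below r k m x = r by exact: H.
elim: m => [_|m IH mk] /=.
  by apply/min_idPl; rewrite le_max; apply/orP; right; lra.
rewrite IH ?(ltnW mk) //; apply/min_idPl; rewrite le_max; apply/orP; right.
by have := xj _ mk; lra.
Qed.

(* For [k >= 1] the bump at scale [r] vanishes on the [r]-ball around [z 0]; this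
   is what makes the family of coordinates finitely supported across scales. *)
Definition bump_coord x (q : nat) : R :=
  if pickle_inv q is Some (r, k) then bump r.+1%:R k.+1 x else 0.

Lemma bump_coord_lip x y q : `|bump_coord x q - bump_coord y q| <= d x y.
Proof.
rewrite /bump_coord; case: pickle_inv => [[r k]|]; first exact: bump_lip.
by rewrite subrr normr0 ms_dist_ge0.
Qed.

(** One of the points, say [x], is farther than [2 * r.+1] from [z 0], so the first [z k] within
    that distance of [x] has positive index. Its bump is full at [x] and 0 at [y], which is at least
    [5 - 2 = 3] radii away from it. *)
Lemma bump_coord_separates x y (r : nat) :
  (forall x (e : R), 0 < e -> exists k, d x (z k) < e) ->
  5 * r.+1%:R <= d x y -> exists q, r.+1%:R <= `|bump_coord x q - bump_coord y q|.
Proof.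
move=> z_dense; have r0 : 0 < r.+1%:R :> R by [].
wlog xz0 : x y / 2 * r.+1%:R < d x (z 0) => [H xy|xy].
  have [xz|xz] := ltP (2 * r.+1%:R) (d x (z 0)); first exact: H.
  have yz : 2 * r.+1%:R < d y (z 0).
    by have := ms_dist_triangle x (z 0) y; rewrite (ms_dist_sym (z 0) y); lra.
  by have [|q] := H y x yz; [rewrite ms_dist_sym|rewrite distrC; exists q].
have ex_k : exists k, d x (z k) <= 2 * r.+1%:R.
  by have [|k /ltW xk] := z_dense x (2 * r.+1%:R); [rewrite mulr_gt0|exists k].
case: (ex_minnP ex_k) => -[|k] xk k_min; first by move: xk; rewrite leNgt xz0.
exists (pickle (r, k)); rewrite /bump_coord pickleK_inv.
rewrite bump_full // => [|j jk]; last first.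
  by rewrite leNgt; apply/negP => /ltW /k_min; rewrite leqNgt jk.
have -> : bump r.+1%:R k.+1 y = 0; last by rewrite subr0 ler_norm.
apply: bump_eq0_far; first exact: ltW.
by have := ms_dist_triangle x (z k.+1) y; rewrite (ms_dist_sym (z k.+1) y); lra.
Qed.

(** Scales beyond the distance to [z 0] vanish thanks to [z 0]; at every scale the indices after [j]
    vanish thanks to [z j]. Finitely many pairs remain. *)
Lemma bump_coord_finite x : (exists k, d x (z k) < 1) ->
  exists b, forall q, (b <= q)%N -> bump_coord x q = 0.
Proof.
move=> [j xj]; have [B xB] := ex_nat_ge (d x (z 0)).
exists (\max_(r < B) \max_(k < j) (pickle (r : nat, k : nat))).+1 => q.
rewrite /bump_coord; case E : (pickle_inv q) => [[r k]|//].
have <- : pickle (r, k) = q by have := @pickle_invK (nat * nat)%type q; rewrite E.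
case: (ltnP r B) => rB; last first.
  move=> _; apply: (@bump_eq0_near _ _ 0) => //.
  by apply: le_trans xB _; rewrite ler_nat ltnW.
case: (ltnP k j) => kj; last first.
  move=> _; apply: (@bump_eq0_near _ _ j) => //.
  by apply: le_trans (ltW xj) _; rewrite ler1n.
rewrite ltnNge => /negP[].
apply: leq_trans (leq_bigmax (Ordinal rB)).
exact: (@leq_bigmax _ (fun k : 'I_j => pickle (r, k : nat)) (Ordinal kj)).
Qed.

Lemma bump_coord_base q : bump_coord (z 0) q = 0.
Proof.
rewrite /bump_coord; case: pickle_inv => [[r k]|//].
by rewrite (@bump_eq0_near _ _ 0) // ms_dist_self.
Qed.

(* Every [z j] is listed at arbitrarily late positions [2 ^ j * 3 ^ l], one of
   which lies beyond the support of its coordinates. *)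
Lemma adapted_enumeration : (forall x (e : R), 0 < e -> exists k, d x (z k) < e) ->
  exists p : nat -> N, (forall i q, (i < q)%N -> bump_coord (p i) q = 0) /\
    forall x (e : R), 0 < e -> exists i, d x (p i) < e.
Proof.
move=> z_dense.
pose fits i := `[< forall q, (i < q)%N -> bump_coord (z (logn 2 i)) q = 0 >].
exists (fun i => if fits i then z (logn 2 i) else z 0); split.
  move=> i q iq; case: ifP => [/asboolP|_]; first exact.
  exact: bump_coord_base.
move=> x e /(z_dense x)[j xj].
have [b bP] := bump_coord_finite (z_dense (z j) 1 ltr01).
have E : logn 2 (2 ^ j * 3 ^ b) = j.
  by rewrite lognM ?expn_gt0 // pfactorK // lognX muln0 addn0.
exists (2 ^ j * 3 ^ b)%N; rewrite E ifT //.
apply/asboolP => q bq; rewrite E bP //.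
apply: leq_trans (ltnW bq); apply: leq_trans (leq_pmull _ (expn_gt0 2 j)).
exact/ltnW/ltn_expl.
Qed.

End Metric.

(** The moduli are the extremal ones. Adjoining 0 to [A t] and [t] to [B t] keeps the sets nonempty,
    and [t] does not stop the infimum from tending to infinity. *)
Lemma coarse_embedding_moduli (R : realType) (N M : metric_space R) (f : N -> M) :
  (forall r : nat, exists w : R, forall x y, ms_dist x y <= r%:R ->
    ms_dist (f x) (f y) <= w) ->
  (forall r : nat, exists T : R, forall x y, T <= ms_dist x y ->
    r%:R <= ms_dist (f x) (f y)) ->
  coarse_embedding (@ms_dist R N) (@ms_dist R M) f.
Proof.
move=> upper lower.
pose dM x y := ms_dist (f x) (f y).
pose A t := [set v | v = 0 \/ exists x y, ms_dist x y <= t /\ v = dM x y].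
pose B t := [set v | v = t \/ exists x y, t <= ms_dist x y /\ v = dM x y].
have supA t : has_sup (A t).
  split; first by exists 0; left.
  have [r tr] := ex_nat_ge t; have [w wP] := upper r.
  exists (Num.max 0 w) => _ [->|[x [y [xy ->]]]]; first by rewrite le_max lexx.
  by rewrite le_max wP ?orbT // (le_trans xy).
have lbB t : 0 <= t -> lbound (B t) 0.
  by move=> t0 _ [->//|[x [y [_ ->]]]]; exact: ms_dist_ge0.
have infB t : 0 <= t -> has_inf (B t).
  by move=> t0; split; [exists t; left|exists 0; exact: lbB].
exists (fun t => inf (B t)), (fun t => sup (A t)); split; last split; last split.
- move=> t t0; split; last by apply: sup_upper_bound => //; left.
  by apply: lb_le_inf; [exact: (infB _ t0).1|exact: lbB].
- move=> s t s0 st; have t0 := le_trans s0 st; split.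
    apply: lb_le_inf; first exact: (infB _ t0).1.
    move=> _ [->|[x [y [xy ->]]]].
      by apply: le_trans st; apply: ge_inf; [exact: (infB _ s0).2|left].
    apply: ge_inf; first exact: (infB _ s0).2.
    by right; exists x, y; split=> //; exact: le_trans xy.
  apply: ge_sup; first exact: (supA s).1.
  move=> _ [->|[x [y [xy ->]]]]; apply: sup_upper_bound => //; first by left.
  by right; exists x, y; split=> //; exact: le_trans st.
- move=> K; have [r Kr] := ex_nat_ge K; have [T TP] := lower r.
  exists (Num.max (Num.max T K) 0) => t; rewrite !ge_max => /andP[/andP[Tt Kt] t0].
  apply: lb_le_inf; first exact: (infB _ t0).1.
  move=> _ [->//|[x [y [xy ->]]]].
  by apply: le_trans Kr (TP _ _ _); exact: le_trans xy.
- move=> x y; split.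
    by apply: ge_inf; [exact: (infB _ (ms_dist_ge0 x y)).2|right; exists x, y].
  by apply: sup_upper_bound => //; right; exists x, y.
Qed.

(** * The tree of partial coarse embeddings *)

Section ApproximationTree.
Variables (R : realType) (N M : metric_space R) (p : nat -> N) (D : nat -> M).
Notation entry := (nat * nat * nat)%type.
Implicit Types (s t u : seq entry).

(* The entry [(T, w, v)] at position [r] records the image [D v] of [p r] and the
   moduli at scale [r]: distances at least [T] stay at least [r], and distances
   at most [r] stay at most [w]. *)
Definition legit s := forall i j r,
  (i < size s)%N -> (j < size s)%N -> (r < size s)%N ->
  let e := nth (0, 0, 0)%N s r in
  let dM := ms_dist (D (nth (0, 0, 0)%N s i).2) (D (nth (0, 0, 0)%N s j).2) in
  (ms_dist (p i) (p j) <= r%:R -> dM <= e.1.2%:R) /\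
  (e.1.1%:R <= ms_dist (p i) (p j) -> r%:R <= dM).

Lemma legit_take k s : legit s -> legit (take k s).
Proof.
move=> Ls i j r; rewrite size_take_min !leq_min => /andP[ik is_] /andP[jk js] /andP[rk rs].
by rewrite !nth_take //; exact: Ls.
Qed.

(** The strict prefix order on legitimate sequences, transported to numbers by [pickle]; numbers
    coding no such sequence are related to nothing. *)
Definition legit_prec (a b : nat) := exists t k,
  [/\ legit t, (k < size t)%N, b = pickle t & a = pickle (take k t)].

Lemma legit_prec_tree :
  ~ (exists s : nat -> entry, forall k, legit (mkseq s k)) -> tree_like legit_prec.
Proof.
have pickle_inj : injective (@pickle (seq entry)) by exact: (pcan_inj pickleK).
move=> no_branch; split.
- move=> _ [t [k [_ kt -> /pickle_inj tk]]].
  by have := congr1 size tk; rewrite size_take kt => E; rewrite E ltnn in kt.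
- move=> _ _ _ [t [k [Lt kt -> ->]]] [t' [k' [Lt' kt' -> /pickle_inj tE]]].
  have kk' : (k < k')%N by move: kt; rewrite tE size_take_min leq_min => /andP[].
  exists t', k; split=> //; first exact: ltn_trans kt'.
  by rewrite tE take_takel // ltnW.
- move=> b; have [[t ->]|no_t] := pselect (exists t, b = pickle t); last first.
    by exists 0%N => a [t [k [_ _ bt _]]]; case: no_t; exists t.
  exists (\max_(k < size t) pickle (take k t)).+1 => a [t' [k [_ kt /pickle_inj tt' ->]]].
  rewrite ltnS; rewrite -tt' in kt *.
  exact: (@leq_bigmax _ (fun k : 'I_(size t) => pickle (take k t)) (Ordinal kt)).
move=> [c cP].
have /choice[t /choice[k tP]] n : exists t k,
  [/\ legit t, (k < size t)%N, c n.+1 = pickle t & c n = pickle (take k t)] := cP n.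
have t_step n : t n = take (k n.+1) (t n.+1).
  by have [_ _ /esym E _] := tP n; have [_ _ _ E'] := tP n.+1; apply: pickle_inj; rewrite E.
have size_t n : (size (t n) < size (t n.+1))%N.
  have [_ kt _ _] := tP n.+1.
  by rewrite {1}(t_step n) size_take_min (leq_ltn_trans _ kt) // geq_minl.
have t_prefix n m : (n <= m)%N -> t n = take (size (t n)) (t m).
  elim: m => [|m IH]; first by rewrite leqn0 => /eqP ->; rewrite take_size.
  rewrite leq_eqVlt => /predU1P[->|nm]; first by rewrite take_size.
  rewrite [LHS]IH // (t_step m) take_takel //.
  have := congr1 size (IH nm); rewrite size_take_min => E.
  have E' : (size (t n) <= size (t m))%N by rewrite E geq_minr.
  apply: leq_trans E' _; rewrite (t_step m) size_take_min geq_minl //.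
have lt_size n : (n < size (t n))%N.
  elim: n => [|n IH]; last exact: leq_ltn_trans IH (size_t n).
  by have [_ + _ _] := tP 0%N; exact: leq_ltn_trans.
(* The sequences [t n] extend one another and [t i] is longer than [i], so the diagonal reads off
   their common limit. *)
apply: no_branch; exists (fun i => nth (0, 0, 0)%N (t i) i) => n.
rewrite (_ : mkseq _ n = take n (t n)); first by apply: legit_take; have [] := tP n.
have sz : size (take n (t n)) = n by rewrite size_takel // ltnW.
apply: (@eq_from_nth _ (0, 0, 0)%N); rewrite size_mkseq // => i iN.
by rewrite nth_mkseq // nth_take // (t_prefix i n (ltnW iN)) nth_take.
Qed.

(** Each point is moved to some [p i] within distance 1. Distances change by at most 2, whence the
    shifted scale [r.+2] and the threshold increased by 2. *)
Lemma legit_branch_coarse (s : nat -> entry) :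
  (forall x (e : R), 0 < e -> exists i, ms_dist x (p i) < e) ->
  (forall k, legit (mkseq s k)) ->
  exists f : N -> M, coarse_embedding (@ms_dist R N) (@ms_dist R M) f.
Proof.
move=> p_dense Ls.
have sP i j r : (ms_dist (p i) (p j) <= r%:R ->
      ms_dist (D (s i).2) (D (s j).2) <= (s r).1.2%:R) /\
    ((s r).1.1%:R <= ms_dist (p i) (p j) -> r%:R <= ms_dist (D (s i).2) (D (s j).2)).
  pose n := (i + j + r).+1.
  have [iN jN rN] : [/\ i < n, j < n & r < n]%N by split; rewrite /n; lia.
  by have := Ls n i j r; rewrite size_mkseq !nth_mkseq //; exact.
have /choice[c cP] x : exists i, ms_dist x (p i) < 1 := p_dense x 1 ltr01.
have near_c x y : ms_dist (p (c x)) (p (c y)) <= ms_dist x y + 2 /\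
    ms_dist x y <= ms_dist (p (c x)) (p (c y)) + 2.
  have := cP x; have := cP y.
  have := ms_dist_triangle (p (c x)) x (p (c y)); have := ms_dist_triangle x y (p (c y)).
  have := ms_dist_triangle x (p (c x)) y; have := ms_dist_triangle (p (c x)) (p (c y)) y.
  rewrite (ms_dist_sym (p (c x)) x) (ms_dist_sym (p (c y)) y).
  by move=> *; split; lra.
exists (fun x => D (s (c x)).2); apply: coarse_embedding_moduli => r.
  exists (s r.+2).1.2%:R => x y xy; apply: (sP _ _ _).1.
  have -> : r.+2%:R = r%:R + 2 :> R by rewrite -addn2 natrD.
  by have [H _] := near_c x y; lra.
exists ((s r).1.1%:R + 2) => x y xy; apply: (sP _ _ _).2.
by have [_ H] := near_c x y; lra.
Qed.

End ApproximationTree.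

(** * Growing a branch from a coarse embedding of the antichain space *)

Section Branch.
Variables (R : realType) (N M : metric_space R) (z p : nat -> N) (D : nat -> M).
Hypothesis z_dense : forall x (e : R), 0 < e -> exists k, ms_dist x (z k) < e.
Hypothesis p_supp : forall i q, (i < q)%N -> bump_coord z (p i) q = 0.
Hypothesis D_dense : forall x (e : R), 0 < e -> exists k, ms_dist x (D k) < e.
Hypothesis prec_tree : tree_like (legit_prec p D).
Notation entry := (nat * nat * nat)%type.
Notation G := (anti_norming R prec_tree).
Notation X := (seqsp G).

(* The coordinates of [p k] are placed along the prefixes of the node already
   built, where the norm of the space is the sup norm. *)
Lemma embedding_legit_branch (f : X -> M) :
  coarse_embedding (@norm_dist R X) (@ms_dist R M) f ->
  exists s : nat -> entry, forall k, legit p D (mkseq s k).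
Proof.
move=> [rho [om [_ [mono [rho_lim fP]]]]].
(* The margin 2, here and for [T], absorbs replacing two values of [f] by points of [D] within
   distance 1. *)
have /choice[w wP] (r : nat) : exists n : nat, om r%:R + 2 <= n%:R := ex_nat_ge _.
have /choice[T TP] (r : nat) : exists n : nat, forall t, n.+1%:R <= t -> r%:R + 2 <= rho t.
  have [T0 T0P] := rho_lim (r%:R + 2); have [n Tn] := ex_nat_ge T0.
  exists n => t nt; apply: T0P; apply: le_trans Tn (le_trans _ nt).
  by rewrite ler_nat.
have /choice[V VP] (x : X) : exists v, ms_dist (f x) (D v) < 1 := D_dense (f x) ltr01.
(* Coordinates 0 to [k] sit at the prefixes of length 0 to [k], so a node of length [k] determines
   the image of [p k] before entry [k] is chosen. *)
pose vec k (u : seq entry) : X :=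
  \sum_(q < k.+1) bump_coord z (p k) q *: delta G (pickle (take q u)).
(* By [bump_coord_separates], distances of at least [5 * (T k).+1] give norms of at least
   [(T k).+1], where [rho] is at least [k + 2]. *)
pose t := fix t k : seq entry := if k is k'.+1
  then rcons (t k') ((5 * (T k').+1)%N, w k', V (vec k' (t k'))) else [::].
pose s k : entry := ((5 * (T k).+1)%N, w k, V (vec k (t k))).
have tE k : t k = mkseq s k by elim: k => // k IH; rewrite mkseqS -IH.
have take_t q k : (q <= k)%N -> take q (t k) = t q.
  by move=> qk; rewrite !tE /mkseq -map_take take_iota (minn_idPl qk).
pose b q := pickle (t q).
have b_inj : injective b.
  move=> q q' /(pcan_inj pickleK) /(congr1 size).
  by rewrite !tE !size_mkseq.
have vecE k m : (k < m)%N ->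
    vec k (t k) = \sum_(q < m) bump_coord z (p k) q *: delta G (b q).
  move=> km; rewrite /vec (big_ord_widen m (fun q =>
    bump_coord z (p k) q *: delta G (pickle (take q (t k))))) // big_mkcond /=.
  apply: eq_bigr => q _; case: ltnP => [qk|kq]; last by rewrite p_supp // scale0r.
  by rewrite take_t.
(* The norm estimates for the points before [k] use the chain of nodes [t q] with [q < k],
   legitimate by induction. *)
exists s => k; rewrite -tE; elim/ltn_ind: k => k IH.
pose x i := vec i (t i).
have xE i j : (i < k)%N -> (j < k)%N -> x i - x j =
    \sum_(q < k) (bump_coord z (p i) q - bump_coord z (p j) q) *: delta G (b q).
  move=> ik jk; rewrite /x !(vecE _ k) // -sumrB.
  by apply: eq_bigr => q _; rewrite scalerBl.
have x_le i j : (i < k)%N -> (j < k)%N -> norm_dist (x i) (x j) <= ms_dist (p i) (p j).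
  move=> ik jk; rewrite /norm_dist xE //; apply: norm_chain_le => [|q q' qq' q'k|q].
  - exact: ms_dist_ge0.
  - exists (t q'), q; split=> //; first exact: IH.
      by rewrite tE size_mkseq.
    by rewrite take_t // ltnW.
  - exact: bump_coord_lip.
have x_ge i j (r : nat) : (i < k)%N -> (j < k)%N ->
    5 * r.+1%:R <= ms_dist (p i) (p j) -> r.+1%:R <= norm_dist (x i) (x j).
  move=> ik jk /(bump_coord_separates z_dense)[q qP].
  apply: le_trans qP _; rewrite /norm_dist xE //.
  case: (ltnP q k) => [qk|kq]; last first.
    by rewrite !p_supp ?subrr ?normr0 // (leq_trans _ kq).
  rewrite -(chain_coef prec_tree (fun q : 'I_k => bump_coord z (p i) q - bump_coord z (p j) q)
    (Ordinal qk) b_inj).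
  exact: seqsp_coef_le.
move=> i j r; rewrite tE size_mkseq => ik jk rk; rewrite !nth_mkseq //=.
have [flo fup] := fP (x i) (x j).
have := VP (x i); have := VP (x j).
rewrite -/(x i) -/(x j); set vi := D (V (x i)); set vj := D (V (x j)) => fj fi.
have x0 : 0 <= norm_dist (x i) (x j) by exact: normr_ge0.
split=> dr.
  have om_le : om (norm_dist (x i) (x j)) <= om r%:R.
    by apply: (mono _ _ x0 _).2; exact: le_trans (x_le _ _ ik jk) dr.
  have := wP r; have := ms_dist_triangle vi (f (x i)) vj.
  have := ms_dist_triangle (f (x i)) (f (x j)) vj.
  by rewrite (ms_dist_sym vi (f (x i))); lra.
have rho_ge : r%:R + 2 <= rho (norm_dist (x i) (x j)).
  by apply: TP; apply: x_ge => //; rewrite natrM in dr.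
have := ms_dist_triangle (f (x i)) vi (f (x j)).
have := ms_dist_triangle vi vj (f (x j)).
by rewrite (ms_dist_sym vj (f (x j))); lra.
Qed.

End Branch.

(** The space of the empty order embeds into [M], which provides a point of [M]. *)
Lemma empty_tree_like : tree_like (fun _ _ => False).
Proof.
split; first by move=> i [].
- by move=> i j k [].
- by move=> j; exists 0%N.
- by move=> [c cP]; case: (cP 0%N).
Qed.

Theorem theoremC (R : realType) (M : metric_space R) :
  separable_ms M ->
  (forall X : completeNormedModType R,
     separable_normed X -> reflexive_space X -> asymptotic_c0 X ->
     exists f : X -> M, coarse_embedding (@norm_dist R X) (@ms_dist R M) f) ->
  forall N : metric_space R, separable_ms N ->
    exists f : N -> M, coarse_embedding (@ms_dist R N) (@ms_dist R M) f.
Proof.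
move=> sepM embM N sepN.
have emb prec (H : tree_like prec) : exists f : seqsp (anti_norming R H) -> M,
    coarse_embedding (@norm_dist R (seqsp (anti_norming R H))) (@ms_dist R M) f.
  apply: embM.
  - exact: (seqsp_separable (@anti_bc _ _ H)).
  - exact: (seqsp_reflexive (@anti_bc _ _ H) (@anti_c0 _ _ H)).
  - exact: (seqsp_asymptotic_c0 (@anti_bc _ _ H) (@anti_c0 _ _ H)).
have [f0 _] := emb _ empty_tree_like.
have [D D_dense] := dense_sequence (f0 0) sepM.
have [[x0 _]|noN] := pselect (exists x : N, True); last first.
  have emptyN (x : N) : False by apply: noN; exists x.
  exists (fun x => False_rect M (emptyN x)).
  by apply: coarse_embedding_moduli => r; exists 0 => x; case: (emptyN x).
have [z z_dense] := dense_sequence x0 sepN.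
have [p [p_supp p_dense]] := adapted_enumeration z_dense.
suff [s Ls] : exists s, forall k, legit p D (mkseq s k).
  exact: legit_branch_coarse Ls.
apply: contrapT => no_branch.
have [f fP] := emb _ (legit_prec_tree no_branch).
exact: (no_branch (embedding_legit_branch z_dense p_supp D_dense fP)).
Qed.
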